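(* Let $k$ be a commutative ring and $A$ a unital associative $k$-algebra. Then $HS_i(A)$ for $i=0,1$ is the homology (in degrees $0$ and $1$) of the following partial chain complex of $k$-modules (tensor products over $k$) $$0\longleftarrow A \stackrel{\partial_1}{\longleftarrow} A\otimes A\otimes A \stackrel{\partial_2}{\longleftarrow}(A\otimes A\otimes A\otimes A)\oplus A,$$ where $$\partial_1 : a\otimes b\otimes c \mapsto abc - cba,$$ $$\partial_2 : \left\{\begin{array}{lll} a\otimes b\otimes c\otimes d &\mapsto& ab\otimes c\otimes d + d\otimes ca\otimes b + bca\otimes 1\otimes d + d\otimes bc\otimes a,\\ a &\mapsto& 1\otimes a\otimes 1. \end{array}\right.$$
   Context: Put $[n]=\{0,1,\dots,n\}$. The category $\Delta S$ has objects $[n]$, $n\ge 0$; a morphism $\alpha:[n]\to[m]$ is a set map together with a total ordering on each fiber. Composition composes the set maps, and the fibers of $\beta\alpha$ are ordered lexicographically (first by the order of $\alpha(i)$ in the fiber of $\beta$, then by the order in the fiber of $\alpha$). $B_*^{sym}A:\Delta S\to k\text{-}\mathbf{Mod}$ is the functor $[n]\mapsto A^{\otimes(n+1)}$ with $\alpha:[n]\to[m]$ sending $a_0\otimes\dots\otimes a_n$ to $b_0\otimes\dots\otimes b_m$, where $b_j$ is the product of the $a_i$, $i\in\alpha^{-1}(j)$, in the given order ($b_j=1_A$ if the fiber is empty). For a contravariant functor $M$ and a covariant functor $N$ from $\Delta S$ to $k$-modules, $M\otimes_{\Delta S}N=\bigoplus_X M(X)\otimes_k N(X)$ modulo $y\otimes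 f_*(x)\approx f^*(y)\otimes x$, and $\mathrm{Tor}^{\Delta S}_*$ denotes its derived functors. The symmetric homology of $A$ is $HS_*(A)=\mathrm{Tor}_*^{\Delta S}(\underline{k},B_*^{sym}A)$, with $\underline{k}$ the constant contravariant functor with value $k$. *)

(* Defs.v *)
From HB Require Import structures.
From mathcomp Require Import all_boot all_order all_algebra.
From mathcomp Require Import finmap boolp.
From mathcomp.multinomials Require Import monalg.

Set Implicit Arguments.
Unset Strict Implicit.
Unset Printing Implicit Defensive.

Import GRing.Theory.
Local Open Scope ring_scope.
Local Open Scope quotient_scope.

(* MathComp's algType forces 1 != 0; the following structure does not, so that
   the zero algebra (and the zero base ring) is allowed. *)
Record unital_algebra (k : comPzRingType) := UnitalAlgebra {
  alg_module : lmodType k;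
  alg_one : alg_module;
  alg_mul : alg_module -> alg_module -> alg_module;
  alg_mulA : associative alg_mul;
  alg_mul1l : left_id alg_one alg_mul;
  alg_mul1r : right_id alg_one alg_mul;
  alg_mulDl : left_distributive alg_mul +%R;
  alg_mulDr : right_distributive alg_mul +%R;
  alg_mulZl : forall c a b, alg_mul (c *: a) b = c *: alg_mul a b;
  alg_mulZr : forall c a b, alg_mul a (c *: b) = c *: alg_mul a b
}.

Definition alg_sort (k : comPzRingType) (A : unital_algebra k) : Type :=
  alg_module A.
Coercion alg_sort : unital_algebra >-> Sortclass.

HB.instance Definition _ (k : comPzRingType) (A : unital_algebra k) :=
  GRing.Lmodule.on (alg_sort A).
HB.instance Definition _ (k : comPzRingType) (A : unital_algebra k) :=
  GRing.Zmodule_isPzRing.Build (alg_sort A)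
    (@alg_mulA k A) (@alg_mul1l k A) (@alg_mul1r k A)
    (@alg_mulDl k A) (@alg_mulDr k A).

Section AlgebraTheory.
Variables (k : comPzRingType) (A : unital_algebra k).

Lemma ualg_scaleAl (c : k) (a b : A) : c *: (a * b) = (c *: a) * b.
Proof. exact/esym/alg_mulZl. Qed.
Lemma ualg_scaleAr (c : k) (a b : A) : c *: (a * b) = a * (c *: b).
Proof. exact/esym/alg_mulZr. Qed.

End AlgebraTheory.

Definition unital_algebra_of_algType (k : comNzRingType) (A : algType k) :
    unital_algebra k :=
  @UnitalAlgebra k A 1 *%R (@mulrA A) (@mul1r A) (@mulr1 A) (@mulrDl A)
    (@mulrDr A) (fun c a b => esym (scalerAl c a b))
    (fun c a b => esym (scalerAr c a b)).

Section Quotient.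
Variables (k : pzRingType) (V : lmodType k) (G : V -> Prop).

Definition span : {pred V} := fun v =>
  `[< forall W : {pred V}, GRing.submod_closed W ->
        (forall g, G g -> g \in W) -> v \in W >].

Lemma span_gen g : G g -> g \in span.
Proof. by move=> Gg; apply/asboolP => W _; apply. Qed.

Lemma span_submod_closed : GRing.submod_closed span.
Proof.
split; first by apply/asboolP => W [].
move=> c u v /asboolP hu /asboolP hv; apply/asboolP => W hW GW.
by case: (hW) => _; apply; [apply: hu | apply: hv].
Qed.

HB.instance Definition _ :=
  GRing.isZmodClosed.Build V span (GRing.submod_closedB span_submod_closed).
HB.instance Definition _ :=
  GRing.isScaleClosed.Build k V span
    (GRing.submod_closed_semi span_submod_closed).2.

(* V modulo the submodule generated by G. *)
Definition quotmod : Type := Quotient.quot span.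
HB.instance Definition _ := GRing.Zmodule.on quotmod.

Definition quotmod_pi (v : V) : quotmod := \pi_(Quotient.quot span) v.
Definition quotmod_repr (q : quotmod) : V := repr (q : Quotient.quot span).

Lemma quotmod_reprK q : quotmod_pi (quotmod_repr q) = q.
Proof. exact: reprK. Qed.

Lemma quotmod_piE u v : (quotmod_pi u = quotmod_pi v) <-> (u - v \in span).
Proof.
by rewrite Quotient.idealrBE; split=> [h|/eqP h]; [apply/eqP|].
Qed.

Lemma quotmod_piB : zmod_morphism quotmod_pi.
Proof. by move=> u v; rewrite /quotmod_pi !piE. Qed.
HB.instance Definition _ :=
  GRing.isZmodMorphism.Build V quotmod quotmod_pi quotmod_piB.

Definition quotmod_scale (c : k) (q : quotmod) : quotmod :=
  quotmod_pi (c *: quotmod_repr q).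

Lemma quotmod_piZ c v : quotmod_pi (c *: v) = quotmod_scale c (quotmod_pi v).
Proof.
apply/quotmod_piE; rewrite -scalerBr; apply: rpredZ.
by apply/quotmod_piE; rewrite quotmod_reprK.
Qed.

Lemma quotmod_scaleA a b q :
  quotmod_scale a (quotmod_scale b q) = quotmod_scale (a * b) q.
Proof. by rewrite -[q]quotmod_reprK -!quotmod_piZ scalerA. Qed.
Lemma quotmod_scale1 : left_id 1 quotmod_scale.
Proof. by move=> q; rewrite -[q]quotmod_reprK -!quotmod_piZ scale1r. Qed.
Lemma quotmod_scaleDr : right_distributive quotmod_scale +%R.
Proof.
move=> a p q; rewrite -[q]quotmod_reprK -[p]quotmod_reprK -raddfD.
by rewrite -!quotmod_piZ scalerDr raddfD.
Qed.
Lemma quotmod_scaleDl q : {morph quotmod_scale^~ q : a b / a + b}.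
Proof.
by move=> a b; rewrite -[q]quotmod_reprK -!quotmod_piZ scalerDl raddfD.
Qed.
HB.instance Definition _ := GRing.Zmodule_isLmodule.Build k quotmod
  quotmod_scaleA quotmod_scale1 quotmod_scaleDr quotmod_scaleDl.
HB.instance Definition _ :=
  GRing.isScalable.Build k V quotmod *:%R quotmod_pi quotmod_piZ.

Lemma quotmod_pi_rel u v : G (u - v) -> quotmod_pi u = quotmod_pi v.
Proof. by move=> Guv; apply/quotmod_piE/span_gen. Qed.

Section Lift.
Variables (W : lmodType k) (f : {linear V -> W}) (f0 : forall g, G g -> f g = 0).

Lemma span_lift v : v \in span -> f v = 0.
Proof.
move/asboolP => /(_ (fun v => f v == 0)) h; apply/eqP/h; last first.
  by move=> g Gg; apply/eqP; apply: f0.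
split; rewrite ?unfold_in ?raddf0 // => c u w; rewrite !unfold_in linearP.
by move=> /eqP-> /eqP->; rewrite scaler0 addr0.
Qed.

Definition quotmod_lift_fun (q : quotmod) : W := f (quotmod_repr q).

Lemma quotmod_lift_funE v : quotmod_lift_fun (quotmod_pi v) = f v.
Proof.
apply/eqP; rewrite -subr_eq0 -raddfB; apply/eqP/span_lift/quotmod_piE.
exact: quotmod_reprK.
Qed.

Lemma quotmod_lift_linear : linear quotmod_lift_fun.
Proof.
move=> c p q; rewrite -[q]quotmod_reprK -[p]quotmod_reprK -linearP.
by rewrite !quotmod_lift_funE linearP.
Qed.
HB.instance Definition _ :=
  GRing.isLinear.Build k quotmod W *:%R quotmod_lift_fun quotmod_lift_linear.

Definition quotmod_lift : {linear quotmod -> W} := quotmod_lift_fun.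

Lemma quotmod_liftE v : quotmod_lift (quotmod_pi v) = f v.
Proof. exact: quotmod_lift_funE. Qed.

End Lift.
End Quotient.

Section Kernel.
Variables (k : pzRingType) (U V : lmodType k) (f : {linear U -> V}).

Definition ker_pred : {pred U} := fun u => f u == 0.

Lemma ker_submod_closed : GRing.submod_closed ker_pred.
Proof.
split; rewrite ?unfold_in ?raddf0 // => c u v; rewrite !unfold_in linearP.
by move=> /eqP-> /eqP->; rewrite scaler0 addr0.
Qed.
HB.instance Definition _ :=
  GRing.isZmodClosed.Build U ker_pred (GRing.submod_closedB ker_submod_closed).
HB.instance Definition _ :=
  GRing.isScaleClosed.Build k U ker_pred
    (GRing.submod_closed_semi ker_submod_closed).2.

Record kermod : predArgType :=
  Kermod { kermod_val : U; kermod_valP : kermod_val \in ker_pred }.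
HB.instance Definition _ := [isSub for kermod_val].
HB.instance Definition _ := [Choice of kermod by <:].
HB.instance Definition _ := [SubChoice_isSubLmodule of kermod by <:].

Lemma kermod0 (x : kermod) : f (val x) = 0.
Proof. exact/eqP/(valP x). Qed.

Lemma in_ker u : f u = 0 -> u \in ker_pred.
Proof. by move=> h; rewrite unfold_in h. Qed.

End Kernel.

(* Homology at C1 of C2 -> C1 -> C0: ker d1 modulo the boundaries. *)
Definition homology (k : pzRingType) (C0 C1 C2 : lmodType k)
    (d1 : {linear C1 -> C0}) (d2 : {linear C2 -> C1}) : lmodType k :=
  quotmod (fun z : kermod d1 => exists y : C2, val z = d2 y).

Definition zeromod (k : pzRingType) : lmodType k := 'M[k]_(0, 0).

Definition lmod_iso (k : pzRingType) (U V : lmodType k) : Prop :=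
  exists f : {linear U -> V}, bijective f.

Section FreeModule.
Variables (k : pzRingType) (K : choiceType).

(* Finitely supported functions K -> k.  The Lmodule instance of {malg k[K]}
   in the library is restricted to nonzero k. *)
Definition freemod : Type := {malg k[K]}.
HB.instance Definition _ := GRing.Zmodule.on freemod.

Definition free_scale (c : k) (g : freemod) : freemod :=
  \sum_(x <- msupp g) mkmalgU x (c * mcoeff x g).

Lemma free_scaleE c g x : mcoeff x (free_scale c g) = c * mcoeff x g.
Proof.
rewrite {2}[g]monalgE !raddf_sum mulr_sumr.
by apply/eq_bigr=> /= i _; rewrite !mcoeffU mulrnAr.
Qed.

Lemma free_scaleA a b g : free_scale a (free_scale b g) = free_scale (a * b) g.
Proof. by apply/malgP=> x; rewrite !free_scaleE mulrA. Qed.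
Lemma free_scale1 : left_id 1 free_scale.
Proof. by move=> g; apply/malgP=> x; rewrite !free_scaleE mul1r. Qed.
Lemma free_scaleDr : right_distributive free_scale +%R.
Proof. by move=> c g h; apply/malgP=> x; rewrite !(mcoeffD, free_scaleE) mulrDr. Qed.
Lemma free_scaleDl g : {morph free_scale^~ g : a b / a + b}.
Proof. by move=> a b; apply/malgP=> x; rewrite !(mcoeffD, free_scaleE) mulrDl. Qed.
HB.instance Definition _ := GRing.Zmodule_isLmodule.Build k freemod
  free_scaleA free_scale1 free_scaleDr free_scaleDl.

Definition free_gen (x : K) : freemod := mkmalgU x 1.

Section Lift.
Variables (W : lmodType k) (h : K -> W).

Definition free_lift_fun (g : freemod) : W :=
  \sum_(x <- msupp g) mcoeff x g *: h x.

Lemma free_lift_funEw (g : freemod) (D : {fset K}) : (msupp g `<=` D)%fset ->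
  free_lift_fun g = \sum_(x <- D) mcoeff x g *: h x.
Proof.
move=> sgD; apply: big_fset_incl => // x _ xg.
by rewrite mcoeff_outdom // scale0r.
Qed.

Lemma free_lift_linear : linear free_lift_fun.
Proof.
move=> c g g'; pose D := (msupp g `|` msupp g' `|` msupp (c *: g + g'))%fset.
rewrite !(@free_lift_funEw _ D) /D; first last.
- by apply/fsubsetP => x xg; rewrite !inE xg ?orbT.
- by apply/fsubsetP => x xg; rewrite !inE xg ?orbT.
- by apply/fsubsetP => x xg; rewrite !inE xg ?orbT.
rewrite scaler_sumr -big_split; apply: eq_bigr => x _ /=.
by rewrite mcoeffD [mcoeff x (c *: g)]free_scaleE scalerDl scalerA.
Qed.
HB.instance Definition _ :=
  GRing.isLinear.Build k freemod W *:%R free_lift_fun free_lift_linear.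

Definition free_lift : {linear freemod -> W} := free_lift_fun.

Lemma free_liftE x : free_lift (free_gen x) = h x.
Proof.
rewrite /= (@free_lift_funEw _ [fset x]%fset) ?msuppU_le //.
by rewrite big_seq_fset1 mcoeffUU scale1r.
Qed.

End Lift.

Lemma free_ext (W : lmodType k) (f g : {linear freemod -> W}) :
  (forall x, f (free_gen x) = g (free_gen x)) -> f =1 g.
Proof.
move=> fg u; have -> : u = \sum_(x <- msupp u) mcoeff x u *: free_gen x.
  rewrite {1}[u]monalgE; apply: eq_bigr => x _; apply/malgP => y.
  by rewrite [RHS]free_scaleE !mcoeffU mulrnAr mulr1.
by rewrite !linear_sum; apply: eq_bigr => x _; rewrite !linearZ_LR fg.
Qed.

End FreeModule.

Section TensorPower.
Variables (k : pzRingType) (V : lmodType k) (n : nat).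

Definition tset (t : n.-tuple V) (i : 'I_n) (x : V) : n.-tuple V :=
  [tuple if j == i then x else tnth t j | j < n].

Definition multilinear (W : lmodType k) (h : n.-tuple V -> W) : Prop :=
  forall t i c x y, h (tset t i (c *: x + y)) = c *: h (tset t i x) + h (tset t i y).

Inductive tpow_rel : freemod k (n.-tuple V) -> Prop :=
  TpowRel t i (c : k) (x y : V) :
    tpow_rel (free_gen k (tset t i (c *: x + y))
              - (c *: free_gen k (tset t i x) + free_gen k (tset t i y))).

(* The n-fold tensor power of V, presented by pure tensors and multilinearity. *)
Definition tpow : lmodType k := quotmod tpow_rel.

Definition tpure (t : n.-tuple V) : tpow := quotmod_pi tpow_rel (free_gen k t).

Lemma tpure_multilinear : multilinear tpure.
Proof.
by move=> t i c x y; rewrite /tpure -linearP; apply: quotmod_pi_rel.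
Qed.

Section Lift.
Variables (W : lmodType k) (h : n.-tuple V -> W) (hM : multilinear h).

Lemma tpow_lift_rel g : tpow_rel g -> free_lift h g = 0.
Proof.
case=> t i c x y; rewrite linearB linearD linearZ_LR !free_liftE hM.
exact: subrr.
Qed.

Definition tpow_lift : {linear tpow -> W} := quotmod_lift tpow_lift_rel.

Lemma tpow_liftE t : tpow_lift (tpure t) = h t.
Proof. by rewrite /tpow_lift /tpure quotmod_liftE free_liftE. Qed.

End Lift.

Lemma tpow_ext (W : lmodType k) (f g : {linear tpow -> W}) :
  (forall t, f (tpure t) = g (tpure t)) -> f =1 g.
Proof.
move=> fg q; rewrite -[q]quotmod_reprK.
exact: (@free_ext _ _ _ (f \o quotmod_pi tpow_rel) (g \o quotmod_pi tpow_rel)).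
Qed.

End TensorPower.

Section DeltaS.

(* A morphism [n] -> [m]: a map together with, for each j, the list of the
   elements of the fiber over j in increasing order. *)
Definition is_DS n m
    (a : {ffun 'I_n.+1 -> 'I_m.+1} * {ffun 'I_m.+1 -> seq 'I_n.+1}) : bool :=
  [forall j, uniq (a.2 j) && [forall i, (i \in a.2 j) == (a.1 i == j)]].

Record DS (n m : nat) : predArgType :=
  MkDS { ds_val : {ffun 'I_n.+1 -> 'I_m.+1} * {ffun 'I_m.+1 -> seq 'I_n.+1};
         ds_valP : is_DS ds_val }.
HB.instance Definition _ n m := [isSub for @ds_val n m].
HB.instance Definition _ n m := [Choice of DS n m by <:].

Definition ds_map n m (a : DS n m) : 'I_n.+1 -> 'I_m.+1 := (ds_val a).1.
Definition ds_fib n m (a : DS n m) : 'I_m.+1 -> seq 'I_n.+1 := (ds_val a).2.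

Lemma ds_fib_uniq n m (a : DS n m) j : uniq (ds_fib a j).
Proof. by have /forallP/(_ j)/andP[] := ds_valP a. Qed.

Lemma mem_ds_fib n m (a : DS n m) j i : (i \in ds_fib a j) = (ds_map a i == j).
Proof. by have /forallP/(_ j)/andP[_ /forallP/(_ i)/eqP] := ds_valP a. Qed.

Lemma ds_eqP n m (a b : DS n m) : ds_fib a =1 ds_fib b -> a = b.
Proof.
move=> ab; apply: val_inj; rewrite /= [LHS]surjective_pairing [RHS]surjective_pairing.
have -> : (ds_val a).2 = (ds_val b).2 by apply/ffunP => j; apply: ab.
congr (_, _); apply/ffunP => i; apply/eqP.
by have := mem_ds_fib b ((ds_val b).1 i) i; rewrite -ab mem_ds_fib eqxx.
Qed.

Lemma ds_id_subproof n :
  @is_DS n n ([ffun i => i], [ffun j => [:: j]]).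
Proof.
apply/forallP => j /=; rewrite !ffunE /=; apply/forallP => i.
by rewrite !ffunE inE.
Qed.
Definition ds_id n : DS n n := MkDS (ds_id_subproof n).

Definition ds_comp_fib n m p (b : DS m p) (a : DS n m) (j : 'I_p.+1) :=
  flatten [seq ds_fib a i | i <- ds_fib b j].

Lemma ds_comp_subproof n m p (b : DS m p) (a : DS n m) :
  is_DS ([ffun i => ds_map b (ds_map a i)], [ffun j => ds_comp_fib b a j]).
Proof.
apply/forallP => j /=; rewrite !ffunE /ds_comp_fib /=; apply/andP; split.
  have := ds_fib_uniq b j; elim: (ds_fib b j) => //= i s IH /andP[si us].
  rewrite cat_uniq ds_fib_uniq IH // andbT; apply/hasPn => x.
  move=> /flatten_mapP[i' si']; rewrite !mem_ds_fib => /eqP->.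
  by apply: contraNneq si => <-.
apply/forallP => i; rewrite !ffunE; apply/eqP; apply/flatten_mapP/eqP => [[x]|<-].
  by rewrite !mem_ds_fib => /eqP<- /eqP->.
by exists (ds_map a i); rewrite mem_ds_fib.
Qed.
Definition ds_comp n m p (b : DS m p) (a : DS n m) : DS n p :=
  MkDS (ds_comp_subproof b a).

Lemma ds_id_fib n j : ds_fib (ds_id n) j = [:: j].
Proof. by rewrite /ds_fib ffunE. Qed.

Lemma ds_comp_fibE n m p (b : DS m p) (a : DS n m) j :
  ds_fib (ds_comp b a) j = flatten [seq ds_fib a i | i <- ds_fib b j].
Proof. by rewrite /ds_fib /= ffunE. Qed.

Lemma ds_comp_mapE n m p (b : DS m p) (a : DS n m) i :
  ds_map (ds_comp b a) i = ds_map b (ds_map a i).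
Proof. by rewrite /ds_map /= ffunE. Qed.

(* The ordering of the fibers of a composite is lexicographic. *)
Lemma ds_comp_lex n m p (b : DS m p) (a : DS n m) j x y :
    x \in ds_fib (ds_comp b a) j -> y \in ds_fib (ds_comp b a) j ->
  let lt q r (c : DS q r) (l : 'I_r.+1) (u v : 'I_q.+1) :=
    (index u (ds_fib c l) < index v (ds_fib c l))%N in
  lt _ _ (ds_comp b a) j x y =
    (if ds_map a x == ds_map a y then lt _ _ a (ds_map a x) x y
     else lt _ _ b j (ds_map a x) (ds_map a y)).
Proof.
move=> + + lt; rewrite {}/lt !ds_comp_fibE; have := ds_fib_uniq b j.
elim: (ds_fib b j) => //= i s IH /andP[si us].
have nfl z : ds_map a z == i -> z \notin flatten [seq ds_fib a i | i <- s].
  move=> /eqP zi; apply/flatten_mapP => -[i' si'].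
  by rewrite mem_ds_fib zi => /eqP ii'; rewrite ii' si' in si.
have fl z : z \in flatten [seq ds_fib a i | i <- s] -> ds_map a z \in s.
  by case/flatten_mapP => i' si'; rewrite mem_ds_fib => /eqP->.
rewrite !mem_cat !index_cat !mem_ds_fib.
rewrite (eq_sym i (ds_map a x)) (eq_sym i (ds_map a y)).
have [xi|xi] /= := eqVneq (ds_map a x) i; have [yi|yi] /= := eqVneq (ds_map a y) i.
- by move=> _ _; rewrite xi yi eqxx.
- move=> _ _; rewrite xi eq_sym (negPf yi) /= ltn0Sn.
  by rewrite ltn_addr // index_mem mem_ds_fib xi.
- move=> _ _; rewrite yi (negPf xi) ltn0.
  apply/negbTE; rewrite -leqNgt ltnW // ltn_addr //.
  by rewrite index_mem mem_ds_fib yi.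
- by move=> xs ys; rewrite ltn_add2l ltnS IH.
Qed.

Lemma ds_comp_id n m (a : DS n m) : ds_comp a (ds_id n) = a.
Proof.
apply: ds_eqP => j; rewrite ds_comp_fibE (eq_map (@ds_id_fib n)).
exact: flatten_seq1.
Qed.

Lemma ds_id_comp n m (a : DS n m) : ds_comp (ds_id m) a = a.
Proof. by apply: ds_eqP => j; rewrite ds_comp_fibE ds_id_fib /= cats0. Qed.

Lemma ds_compA n m p q (c : DS p q) (b : DS m p) (a : DS n m) :
  ds_comp c (ds_comp b a) = ds_comp (ds_comp c b) a.
Proof.
apply: ds_eqP => j; rewrite !ds_comp_fibE.
rewrite (eq_map (fun i => ds_comp_fibE b a i)).
elim: (ds_fib c j) => //= i s IH.
by rewrite IH map_cat flatten_cat.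
Qed.

End DeltaS.

Section Functors.
Variable k : pzRingType.

Record contra_functor := ContraFunctor {
  cf_obj :> nat -> lmodType k;
  cf_map : forall n m, DS n m -> {linear cf_obj m -> cf_obj n};
  cf_id : forall n (x : cf_obj n), cf_map (ds_id n) x = x;
  cf_comp : forall n m p (b : DS m p) (a : DS n m) (x : cf_obj p),
    cf_map (ds_comp b a) x = cf_map a (cf_map b x)
}.

Record co_functor := CoFunctor {
  co_obj :> nat -> lmodType k;
  co_map : forall n m, DS n m -> {linear co_obj n -> co_obj m};
  co_id : forall n (x : co_obj n), co_map (ds_id n) x = x;
  co_comp : forall n m p (b : DS m p) (a : DS n m) (x : co_obj n),
    co_map (ds_comp b a) x = co_map b (co_map a x)
}.

Record nat_trans (F G : contra_functor) := NatTrans {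
  nt_fun :> forall n, {linear F n -> G n};
  nt_natural : forall n m (a : DS n m) (x : F m),
    nt_fun n (cf_map F a x) = cf_map G a (nt_fun m x)
}.

(* Epimorphisms, kernels and images of functors are computed objectwise. *)
Definition nt_epi F G (e : nat_trans F G) : Prop :=
  forall n (y : G n), exists x, e n x = y.

Definition projective (P : contra_functor) : Prop :=
  forall F G (e : nat_trans F G) (f : nat_trans P G), nt_epi e ->
  exists g : nat_trans P F, forall n x, e n (g n x) = f n x.

Record projective_resolution (M : contra_functor) := ProjectiveResolution {
  res_obj :> nat -> contra_functor;
  res_d : forall i, nat_trans (res_obj i.+1) (res_obj i);
  res_aug : nat_trans (res_obj 0) M;
  res_projective : forall i, projective (res_obj i);
  res_aug_epi : nt_epi res_aug;
  res_exact0 : forall n (x : res_obj 0 n),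
    res_aug n x = 0 <-> exists y, x = res_d 0 n y;
  res_exact : forall i n (x : res_obj i.+1 n),
    res_d i n x = 0 <-> exists y, x = res_d i.+1 n y
}.

End Functors.

(* Existence of projective resolutions: cover M by a direct sum of
   representable functors, one for each element of each M n, and iterate on
   kernels. *)
Section FreeResolution.
Variable k : pzRingType.

Section FreeCover.
Variable M : contra_functor k.

Definition cover_gen (p : nat) : choiceType := {n : nat & (M n * DS p n)%type}.
Definition cover_key p n (x : M n) (a : DS p n) : cover_gen p :=
  Tagged (fun n => (M n * DS p n)%type) (x, a).
Definition cover_obj (p : nat) : lmodType k := freemod k (cover_gen p).

Definition cover_map q p (b : DS q p) : {linear cover_obj p -> cover_obj q} :=
  free_lift (fun g : cover_gen p =>
    free_gen k (cover_key (tagged g).1 (ds_comp (tagged g).2 b))).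

Lemma cover_mapE q p n (b : DS q p) (x : M n) (a : DS p n) :
  cover_map b (free_gen k (cover_key x a))
  = free_gen k (cover_key x (ds_comp a b)).
Proof. exact: free_liftE. Qed.

Lemma cover_id p (u : cover_obj p) : cover_map (ds_id p) u = u.
Proof.
apply: (@free_ext _ _ _ (cover_map (ds_id p)) idfun) => -[n [x a]].
by rewrite [LHS](cover_mapE _ x a) ds_comp_id.
Qed.

Lemma cover_comp q p r (b : DS p r) (a : DS q p) (u : cover_obj r) :
  cover_map (ds_comp b a) u = cover_map a (cover_map b u).
Proof.
apply: (@free_ext _ _ _ (cover_map (ds_comp b a)) (cover_map a \o cover_map b)).
case=> n [x c] /=.
rewrite [LHS](cover_mapE _ x c) [X in _ = cover_map a X](cover_mapE _ x c).
by rewrite cover_mapE ds_compA.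
Qed.

Definition cover : contra_functor k := ContraFunctor cover_id cover_comp.

Section CoverLift.
Variables (F : contra_functor k) (s : forall n, M n -> F n).

Definition cover_lift_fun p : {linear cover p -> F p} :=
  free_lift (fun g : cover_gen p => cf_map F (tagged g).2 (s (tagged g).1)).

Lemma cover_lift_funE p n (x : M n) (a : DS p n) :
  cover_lift_fun p (free_gen k (cover_key x a)) = cf_map F a (s x).
Proof. exact: free_liftE. Qed.

Lemma cover_lift_natural q p (b : DS q p) (u : cover p) :
  cover_lift_fun q (cf_map cover b u) = cf_map F b (cover_lift_fun p u).
Proof.
apply: (@free_ext _ _ _ (cover_lift_fun q \o cover_map b)
                        (cf_map F b \o cover_lift_fun p)) => -[n [x a]] /=.
rewrite [X in cover_lift_fun q X](cover_mapE b x a) cover_lift_funE.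
by rewrite cf_comp [X in _ = cf_map F b X]cover_lift_funE.
Qed.

Definition cover_lift : nat_trans cover F := NatTrans cover_lift_natural.

End CoverLift.

Definition cover_pi : nat_trans cover M := cover_lift (fun n (x : M n) => x).

Lemma cover_pi_epi : nt_epi cover_pi.
Proof.
move=> n y; exists (free_gen k (cover_key y (ds_id n))).
by rewrite [LHS]cover_lift_funE cf_id.
Qed.

Lemma cover_projective : projective cover.
Proof.
move=> F G e f e_epi.
have [s sP] : {s : forall n, M n -> F n &
    forall n x, e n (s n x) = f n (free_gen k (cover_key x (ds_id n)))}.
  have H n (x : M n) := cid (e_epi n (f n (free_gen k (cover_key x (ds_id n))))).
  by exists (fun n x => projT1 (H n x)) => n x; apply: (projT2 (H n x)).
exists (cover_lift s) => p u.
apply: (@free_ext _ _ _ (e p \o cover_lift s p) (f p)) => -[n [x a]] /=.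
rewrite [X in e p X](cover_lift_funE s x a) nt_natural sP -nt_natural.
by rewrite [X in f p X](cover_mapE a x (ds_id n)) ds_id_comp.
Qed.

End FreeCover.

Section KernelFunctor.
Variables (F G : contra_functor k) (f : nat_trans F G).

Lemma kerf_subproof n m (a : DS n m) (x : kermod (f m)) :
  cf_map F a (val x) \in ker_pred (f n).
Proof. by apply: in_ker; rewrite nt_natural kermod0 raddf0. Qed.

Definition kerf_fun n m (a : DS n m) (x : kermod (f m)) : kermod (f n) :=
  Kermod (kerf_subproof a x).

Lemma kerf_linear n m (a : DS n m) : linear (@kerf_fun n m a).
Proof. by move=> c x y; apply: val_inj; rewrite /= !linearP. Qed.
HB.instance Definition _ n m (a : DS n m) :=
  GRing.isLinear.Build k (kermod (f m)) (kermod (f n)) *:%R (@kerf_fun n m a)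
    (kerf_linear a).

Definition kerf_map n m (a : DS n m) : {linear kermod (f m) -> kermod (f n)} :=
  @kerf_fun n m a.

Lemma kerf_id n (x : kermod (f n)) : kerf_map (ds_id n) x = x.
Proof. by apply: val_inj; apply: cf_id. Qed.

Lemma kerf_comp n m p (b : DS m p) (a : DS n m) (x : kermod (f p)) :
  kerf_map (ds_comp b a) x = kerf_map a (kerf_map b x).
Proof. by apply: val_inj; apply: cf_comp. Qed.

Definition kerf : contra_functor k :=
  @ContraFunctor k (fun n => kermod (f n)) kerf_map kerf_id kerf_comp.

Definition kerf_incl_fun n : {linear kermod (f n) -> F n} :=
  (val : kermod (f n) -> F n).

Definition kerf_incl : nat_trans kerf F :=
  @NatTrans k kerf F kerf_incl_fun (fun _ _ _ _ => erefl).

End KernelFunctor.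

Definition nt_comp (F G H : contra_functor k) (g : nat_trans G H)
    (f : nat_trans F G) : nat_trans F H.
Proof.
exists (fun n => g n \o f n : {linear F n -> H n}) => n m a x /=.
by rewrite !nt_natural.
Defined.

Variable M : contra_functor k.

Fixpoint syzygy (i : nat) : contra_functor k :=
  if i is i'.+1 then kerf (cover_pi (syzygy i')) else M.

Definition free_res_obj i : contra_functor k := cover (syzygy i).

Definition free_res_d i : nat_trans (free_res_obj i.+1) (free_res_obj i) :=
  nt_comp (kerf_incl (cover_pi (syzygy i))) (cover_pi (syzygy i.+1)).

Lemma free_res_dE i n (y : free_res_obj i.+1 n) :
  free_res_d i n y = val (cover_pi (syzygy i.+1) n y : kermod _).
Proof. by []. Qed.

Lemma free_res_exact i n (x : free_res_obj i n) :
  cover_pi (syzygy i) n x = 0 <-> exists y, x = free_res_d i n y.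
Proof.
split=> [x0|[y ->]]; last by rewrite free_res_dE kermod0.
have [y yE] := cover_pi_epi (Kermod (in_ker x0) : syzygy i.+1 n).
by exists y; rewrite free_res_dE yE.
Qed.

Lemma free_res_exactS i n (x : free_res_obj i.+1 n) :
  free_res_d i n x = 0 <-> exists y, x = free_res_d i.+1 n y.
Proof.
rewrite -free_res_exact free_res_dE; split=> [x0|->]; last exact: raddf0.
by apply: val_inj; rewrite x0 raddf0.
Qed.

Definition free_resolution : projective_resolution M :=
  @ProjectiveResolution k M free_res_obj free_res_d (cover_pi M)
    (fun i => @cover_projective (syzygy i)) (@cover_pi_epi M)
    (@free_res_exact 0) free_res_exactS.

End FreeResolution.

Section TensorDS.
Variable k : comPzRingType.

Section Tensor.
Variables (M : contra_functor k) (N : co_functor k).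

Definition tens_gen : choiceType := {n : nat & (M n * N n)%type}.

Definition tens_key n (y : M n) (x : N n) : freemod k tens_gen :=
  free_gen k (Tagged (fun n => (M n * N n)%type) (y, x)).

(* Generators tens_key y x with the first two families of relations present the
   direct sum over n of the M n (x)_k N n; the third one makes y (x) f_* x equal
   to f^* y (x) x. *)
Inductive tens_rel : freemod k tens_gen -> Prop :=
| TensRelL n (c : k) (y y' : M n) (x : N n) :
    tens_rel (tens_key (c *: y + y') x - (c *: tens_key y x + tens_key y' x))
| TensRelR n (c : k) (y : M n) (x x' : N n) :
    tens_rel (tens_key y (c *: x + x') - (c *: tens_key y x + tens_key y x'))
| TensRelDS n m (f : DS n m) (y : M m) (x : N n) :
    tens_rel (tens_key y (co_map N f x) - tens_key (cf_map M f y) x).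

Definition tensDS : lmodType k := quotmod tens_rel.

Definition tens_pure n (y : M n) (x : N n) : tensDS :=
  quotmod_pi tens_rel (tens_key y x).

Lemma tens_pureDl n (c : k) (y y' : M n) (x : N n) :
  tens_pure (c *: y + y') x = c *: tens_pure y x + tens_pure y' x.
Proof.
by rewrite /tens_pure -linearP; apply: quotmod_pi_rel; exact: TensRelL.
Qed.

Lemma tens_pureDr n (c : k) (y : M n) (x x' : N n) :
  tens_pure y (c *: x + x') = c *: tens_pure y x + tens_pure y x'.
Proof.
by rewrite /tens_pure -linearP; apply: quotmod_pi_rel; exact: TensRelR.
Qed.

Lemma tens_pureDS n m (f : DS n m) (y : M m) (x : N n) :
  tens_pure y (co_map N f x) = tens_pure (cf_map M f y) x.
Proof.
by apply: quotmod_pi_rel; exact: TensRelDS.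
Qed.

End Tensor.

Section TensorMap.
Variables (M M' : contra_functor k) (f : nat_trans M M') (N : co_functor k).

Definition tens_map_gen (g : tens_gen M N) : tensDS M' N :=
  tens_pure (f _ (tagged g).1) (tagged g).2.

Lemma tens_map_rel g : tens_rel g -> free_lift tens_map_gen g = 0.
Proof.
case=> [n c y y' x|n c y x x'|n m a y x];
  rewrite linearB; apply/eqP; rewrite subr_eq0; apply/eqP;
  rewrite ?linearD ?linearZ_LR /= ![free_lift_fun _ _]free_liftE
    /tens_map_gen /=.
- by rewrite linearP tens_pureDl.
- exact: tens_pureDr.
- by rewrite tens_pureDS nt_natural.
Qed.

Definition tens_map : {linear tensDS M N -> tensDS M' N} :=
  quotmod_lift tens_map_rel.

Lemma tens_mapE n (y : M n) (x : N n) :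
  tens_map (tens_pure y x) = tens_pure (f n y) x.
Proof. by rewrite /tens_map /tens_pure quotmod_liftE [LHS]free_liftE. Qed.

End TensorMap.

(* Homology of a complex C 0 <- C 1 <- C 2 <- ... extended by zero. *)
Definition chain_homology (C : nat -> lmodType k)
    (d : forall i, {linear C i.+1 -> C i}) (i : nat) : lmodType k :=
  if i is i'.+1 then homology (d i') (d i'.+1)
  else homology (\0 : {linear C 0 -> zeromod k}) (d 0).

(* Left derived functors of M |-> tensDS M N, computed on a projective
   resolution of M in the category of contravariant functors. *)
Definition Tor (i : nat) (M : contra_functor k) (N : co_functor k) : lmodType k :=
  chain_homology (fun j => tens_map (res_d (free_resolution M) j) N) i.

Definition const_functor : contra_functor k :=
  @ContraFunctor k (fun=> k^o) (fun _ _ _ => idfun) (fun _ _ => erefl)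
    (fun _ _ _ _ _ _ => erefl).

End TensorDS.

Section SymmetricHomology.
Variables (k : comPzRingType) (A : unital_algebra k).

Definition bsym_act n m (a : DS n m) (t : n.+1.-tuple A) : m.+1.-tuple A :=
  [tuple \prod_(i <- ds_fib a j) tnth t i | j < m.+1].

Lemma bsym_act_tset n m (a : DS n m) (t : n.+1.-tuple A) i :
  exists L R : A, forall x,
    bsym_act a (tset t i x) = tset (bsym_act a t) (ds_map a i) (L * x * R).
Proof.
have [s1 [s2 E]] : exists s1 s2, ds_fib a (ds_map a i) = s1 ++ i :: s2.
  have : i \in ds_fib a (ds_map a i) by rewrite mem_ds_fib.
  by case/splitPr => s1 s2; exists s1, s2.
have := ds_fib_uniq a (ds_map a i); rewrite E.
rewrite cat_uniq /= negb_or => /and3P[_ /andP[i1 _] /andP[i2 _]].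
exists (\prod_(l <- s1) tnth t l), (\prod_(l <- s2) tnth t l) => x.
have prodE s : i \notin s ->
    \prod_(l <- s) tnth (tset t i x) l = \prod_(l <- s) tnth t l.
  move=> si; rewrite !big_seq; apply: eq_bigr => l ls; rewrite tnth_mktuple.
  by case: eqP ls => // ->; rewrite (negPf si).
apply: eq_from_tnth => j; rewrite !tnth_mktuple; have [->|ji] := eqVneq j _.
  rewrite E big_cat big_cons tnth_mktuple eqxx !prodE //.
  by rewrite /= mulrA.
by apply: prodE; rewrite mem_ds_fib eq_sym.
Qed.

Lemma bsym_multilinear n m (a : DS n m) :
  multilinear (fun t : n.+1.-tuple A => tpure (bsym_act a t)).
Proof.
move=> t i c x y; have [L [R LR]] := bsym_act_tset a t i.
rewrite !LR -tpure_multilinear mulrDr mulrDl.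
by rewrite ualg_scaleAl ualg_scaleAr.
Qed.

Definition bsym_map n m (a : DS n m) : {linear tpow A n.+1 -> tpow A m.+1} :=
  tpow_lift (bsym_multilinear a).

Lemma bsym_mapE n m (a : DS n m) t :
  bsym_map a (tpure t) = tpure (bsym_act a t).
Proof. exact: tpow_liftE. Qed.

Lemma bsym_id n (x : tpow A n.+1) : bsym_map (ds_id n) x = x.
Proof.
apply: (@tpow_ext _ _ _ _ (bsym_map (ds_id n)) idfun) => t /=.
rewrite [LHS]bsym_mapE; congr tpure; apply: eq_from_tnth => j.
by rewrite tnth_mktuple ds_id_fib big_seq1.
Qed.

Lemma bsym_comp n m p (b : DS m p) (a : DS n m) (x : tpow A n.+1) :
  bsym_map (ds_comp b a) x = bsym_map b (bsym_map a x).
Proof.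
apply: (@tpow_ext _ _ _ _ (bsym_map (ds_comp b a)) (bsym_map b \o bsym_map a)).
move=> t /=; rewrite [LHS]bsym_mapE [X in _ = bsym_map b X]bsym_mapE bsym_mapE.
congr tpure; apply: eq_from_tnth => j; rewrite !tnth_mktuple ds_comp_fibE.
rewrite big_flatten big_map; apply: eq_bigr => i _.
by rewrite tnth_mktuple.
Qed.

Definition bsym : co_functor k :=
  @CoFunctor k (fun n => tpow A n.+1) bsym_map bsym_id bsym_comp.

Definition HS (i : nat) : lmodType k := Tor i (const_functor k) bsym.

End SymmetricHomology.

Section PartialComplex.
Variables (k : comPzRingType) (A : unital_algebra k).

Lemma nth_tset n (t : n.-tuple A) (i : 'I_n) x (j : nat) : (j < n)%N ->
  (tset t i x)`_j = if j == i then x else t`_j.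
Proof.
move=> jn; rewrite -(tnth_nth 0 _ (Ordinal jn)) tnth_mktuple.
by rewrite (tnth_nth 0).
Qed.

Definition pd1_fun (t : 3.-tuple A) : A :=
  let a := t`_0 in let b := t`_1 in let c := t`_2 in
  a * b * c - c * b * a.

Lemma pd1_multilinear : multilinear pd1_fun.
Proof.
move=> t [[|[|[|i]]] //= hi] c x y; rewrite /pd1_fun !nth_tset //=;
  rewrite !(mulrDl, mulrDr) -!(ualg_scaleAl, ualg_scaleAr);
  by rewrite -?ualg_scaleAl opprD addrACA -scalerBr.
Qed.

Definition pd1 : {linear tpow A 3 -> A} := tpow_lift pd1_multilinear.

Lemma pd1E (a b c : A) : pd1 (tpure [tuple a; b; c]) = a * b * c - c * b * a.
Proof. exact: tpow_liftE. Qed.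

Definition pd2_fun (t : 4.-tuple A) : tpow A 3 :=
  let a := t`_0 in let b := t`_1 in let c := t`_2 in let d := t`_3 in
  tpure [tuple a * b; c; d] + tpure [tuple d; c * a; b]
  + tpure [tuple b * c * a; 1; d] + tpure [tuple d; b * c; a].

Lemma tpure3_linear1 (b c : A) : linear (fun a : A => tpure [tuple a; b; c]).
Proof.
move=> r x y; have E a : [tuple a; b; c] = tset [tuple 0; b; c] ord0 a.
  by apply: val_inj; rewrite /= !enum_ordSl enum_ord0.
by rewrite (E (_ + _)) (E x) (E y) tpure_multilinear.
Qed.

Lemma tpure3_linear2 (a c : A) : linear (fun b : A => tpure [tuple a; b; c]).
Proof.
move=> r x y; have E b : [tuple a; b; c] = tset [tuple a; 0; c] (@Ordinal 3 1 isT) b.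
  by apply: val_inj; rewrite /= !enum_ordSl enum_ord0.
by rewrite (E (_ + _)) (E x) (E y) tpure_multilinear.
Qed.

Lemma tpure3_linear3 (a b : A) : linear (fun c : A => tpure [tuple a; b; c]).
Proof.
move=> r x y; have E c : [tuple a; b; c] = tset [tuple a; b; 0] (@Ordinal 3 2 isT) c.
  by apply: val_inj; rewrite /= !enum_ordSl enum_ord0.
by rewrite (E (_ + _)) (E x) (E y) tpure_multilinear.
Qed.

Lemma pd2_multilinear : multilinear pd2_fun.
Proof.
move=> t [[|[|[|[|i]]]] //= hi] c x y; rewrite /pd2_fun !nth_tset //=;
  rewrite ?(mulrDl, mulrDr) -?(ualg_scaleAl, ualg_scaleAr) -?ualg_scaleAl;
  rewrite ?(tpure3_linear1, tpure3_linear2, tpure3_linear3) !scalerDr;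
  rewrite [RHS]addrACA; congr (_ + _); rewrite [RHS]addrACA; congr (_ + _);
  exact: addrACA.
Qed.

Definition pd2_fun_pair (u : tpow A 4 * A) : tpow A 3 :=
  tpow_lift pd2_multilinear u.1 + tpure [tuple 1; u.2; 1].

Lemma pd2_linear : linear pd2_fun_pair.
Proof.
move=> c u v; rewrite /pd2_fun_pair.
rewrite (linearP (tpow_lift pd2_multilinear) c u.1 v.1).
by rewrite (tpure3_linear2 1 1 c u.2 v.2) scalerDr addrACA.
Qed.
HB.instance Definition _ :=
  GRing.isLinear.Build k (tpow A 4 * A)%type (tpow A 3) *:%R pd2_fun_pair
    pd2_linear.

Definition pd2 : {linear (tpow A 4 * A)%type -> tpow A 3} := pd2_fun_pair.

Lemma pd2E (a b c d e : A) :
  pd2 (tpure [tuple a; b; c; d], e)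
  = tpure [tuple a * b; c; d] + tpure [tuple d; c * a; b]
    + tpure [tuple b * c * a; 1; d] + tpure [tuple d; b * c; a]
    + tpure [tuple 1; e; 1].
Proof. by congr (_ + _); apply: tpow_liftE. Qed.

End PartialComplex.

(* Main.v *)
Require Import Defs.
From HB Require Import structures.
From mathcomp Require Import all_boot all_order all_algebra.
From mathcomp Require Import boolp.
Import GRing.Theory.
Local Open Scope ring_scope.

(** The derived functors of the tensor product over the category Delta S can be
    computed in degrees 0 and 1 from any partial projective resolution of the
    constant functor k, that is, from three projective functors with exactness
    at k and at the first two of them (pr_homology_iso, by the usual comparison
    and homotopy argument). The theorem follows from one such resolution built
    from representable functors (small_resolution): since k[DS(-, [m])] tensored
    with N is N [m], tensoring it with the symmetric bar construction gives the
    explicit complex, and its relation pd1 (pd2 u) = 0.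

    Evaluated at [n], the small resolution is a complex about words in the
    letters 0, ..., n in which every letter occurs once. Its first terms are
    spanned by the words and by the triples (X, Y, Z) of words with XYZ such a
    word, with boundary XYZ - ZYX. So it is the chain complex of a graph whose
    vertices are the words and whose edges reverse the order of three
    consecutive blocks; the last term attaches 2-cells to this graph. Exactness
    says that the graph is connected (K_exact0), which is clear because letters
    can be moved around freely, and that its cycles bound (K_exact1), which is
    the heart of the proof.

    For the second point it is enough to find, in the cokernel of the last map,
    a potential s with s(XYZ) - s(ZYX) equal to the class of (X, Y, Z)
    (potential_exists). Edges with an empty block are rotations of words, and
    the 2-cells make their contribution the variation of a function
    (rotation_swap). After subtracting it, the class of an edge is a cost D X Y
    Z that depends only on the cyclic words XYZ and XZY, is antisymmetric, and
    vanishes on the loops that carry a block once around a cyclic word. These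
    loops imply that exchanges of disjoint pairs of blocks commute (defect0),
    and the potential is then the cost of sorting the cyclic word by insertion
    (sorting_swap). *)

Set Implicit Arguments.
Unset Strict Implicit.
Unset Printing Implicit Defensive.

(** * Identities in abelian groups *)

(** The word calculus below produces long identities between signed sums in an
    abelian group that carries no multiplication, so that ring normalisation
    does not apply; they are decided by comparing the integer coefficients of
    the two sides in the free abelian group on their atoms. *)
Inductive zexpr := ZVar of nat | ZZero | ZAdd of zexpr & zexpr | ZOpp of zexpr.

Fixpoint zeval (V : zmodType) (env : seq V) (e : zexpr) : V :=
  match e with
  | ZVar i => env`_i
  | ZZero => 0
  | ZAdd e1 e2 => zeval env e1 + zeval env e2
  | ZOpp e1 => - zeval env e1
  end.

Fixpoint zcoef (e : zexpr) (i : nat) : int :=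
  match e with
  | ZVar j => (j == i)%:Z
  | ZZero => 0
  | ZAdd e1 e2 => zcoef e1 i + zcoef e2 i
  | ZOpp e1 => - zcoef e1 i
  end.

Lemma zevalE (V : zmodType) (env : seq V) (e : zexpr) :
  zeval env e = \sum_(i < size env) env`_i *~ zcoef e i.
Proof.
elim: e => [j||e1 IH1 e2 IH2|e1 IH1] /=.
- have [jn|nj] := ltnP j (size env).
    rewrite (bigD1 (Ordinal jn)) //= eqxx mulr1z big1 ?addr0 // => i ij.
    by rewrite (_ : (j == i) = false) ?mulr0z //; apply/negbTE; rewrite eq_sym.
  rewrite nth_default // big1 // => i _.
  by rewrite gtn_eqF ?mulr0z // (leq_trans (ltn_ord i)).
- by rewrite big1 // => i _; rewrite mulr0z.
- by rewrite IH1 IH2 -big_split; apply: eq_bigr => i _; rewrite mulrzDr.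
- by rewrite IH1 -sumrN; apply: eq_bigr => i _; rewrite mulrNz.
Qed.

Lemma zeval_eq (V : zmodType) (env : seq V) (e1 e2 : zexpr) :
  all (fun i => zcoef e1 i == zcoef e2 i) (iota 0 (size env)) ->
  zeval env e1 = zeval env e2.
Proof.
move=> /allP h; rewrite !zevalE; apply: eq_bigr => i _.
by have /h/eqP-> : (i : nat) \in iota 0 (size env) by rewrite mem_iota ltn_ord.
Qed.

Ltac zindex x env :=
  lazymatch env with
  | x :: _ => constr:(0%N)
  | _ :: ?env' => let i := zindex x env' in constr:(S i)
  end.

Ltac zadd_var x env :=
  match env with
  | _ => let _ := zindex x env in constr:(env)
  | _ => constr:(x :: env)
  end.

Ltac zvars e env :=
  lazymatch e with
  | (?a + ?b)%R => let env' := zvars a env in zvars b env'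
  | (- ?a)%R => zvars a env
  | 0%R => constr:(env)
  | _ => zadd_var e env
  end.

Ltac zreify e env :=
  lazymatch e with
  | (?a + ?b)%R =>
      let a' := zreify a env in let b' := zreify b env in constr:(ZAdd a' b')
  | (- ?a)%R => let a' := zreify a env in constr:(ZOpp a')
  | 0%R => constr:(ZZero)
  | _ => let i := zindex e env in constr:(ZVar i)
  end.

Ltac zmodule :=
  lazymatch goal with
  | |- @eq ?V ?l ?r =>
      let env := zvars l (@nil V) in let env := zvars r env in
      let l' := zreify l env in let r' := zreify r env in
      change (zeval env l' = zeval env r');
      apply: zeval_eq; vm_compute; reflexivity
  end.

(** To prove a = b from a known equation, it is enough that the two differences
    of sides agree formally. *)
Lemma eq_from_diff (V : zmodType) (a b l r : V) :
  l = r -> a - b = l - r -> a = b.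
Proof. by move=> -> /eqP; rewrite subrr subr_eq0 => /eqP. Qed.

Tactic Notation "zcombine" constr(h) := refine (eq_from_diff h _); zmodule.

Lemma eqD (V : zmodType) (a b c d : V) : a = b -> c = d -> a + c = b + d.
Proof. by move=> -> ->. Qed.
Lemma eqB (V : zmodType) (a b c d : V) : a = b -> c = d -> a - c = b - d.
Proof. by move=> -> ->. Qed.

(** * A potential for exchanges of blocks in a cyclic word *)

(** D X Y Z is the cost of passing from the cyclic word XYZ to the cyclic word
    XZY. The first two hypotheses say that this cost depends on the cyclic words
    only and is reversed by the opposite move; D_turn says that carrying W once
    around the cyclic word XYZ costs nothing. The goal is sorting_swap: such a
    cost is the variation of a function of words. *)
Section Alternating.
Variables (T : eqType) (V : zmodType).
Implicit Types (W X Y Z A B C P U w L : seq T).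

Variable D : seq T -> seq T -> seq T -> V.
Hypothesis D_rot : forall X Y Z, D Y Z X = D X Y Z.
Hypothesis D_swap : forall X Y Z, D X Z Y = - D X Y Z.
Hypothesis D_turn : forall W X Y Z,
  D W X (Y ++ Z) + D W Y (Z ++ X) + D W Z (X ++ Y) = 0.

Lemma D_swap12 X Y Z : D Y X Z = - D X Y Z.
Proof. by rewrite -D_rot D_swap D_rot. Qed.

Lemma D_split_snd W X Y Z : D W (X ++ Y) Z = D W X (Y ++ Z) + D W Y (Z ++ X).
Proof.
have h := D_turn W X Y Z; rewrite (D_swap W (X ++ Y) Z) in h.
zcombine (esym h).
Qed.

Lemma D_nil X Y : D [::] X Y = 0.
Proof.
have := D_turn X [::] Y [::]; rewrite !cats0 (D_swap X [::] Y) /= => h.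
by rewrite -D_rot (D_swap X [::] Y); zcombine (esym h).
Qed.

(** Exchanging X with Y and exchanging Z with W commute when the four blocks
    fill the cyclic word: the discrepancy is the sum of four turns, one for each
    block, in which every other move occurs once in each direction. *)
Lemma D_square4 X Y Z W :
  D X Y (Z ++ W) - D X Y (W ++ Z) = D Z W (X ++ Y) - D Z W (Y ++ X).
Proof.
have h1 := D_turn X Y Z W; have h2 := D_turn Z X W Y.
have h3 := D_turn W X Y Z; have h4 := D_turn Y X W Z.
rewrite (D_swap12 X Z) in h2.
rewrite (D_swap12 X W) (D_swap12 Z W) in h3.
rewrite (D_swap12 X Y) (D_swap12 W Y) (D_swap12 Z Y) in h4.
zcombine (eqD (eqD h1 h2) (eqD h3 h4)).
Qed.

(** The failure of the exchanges of X, Y and of Z, W to commute in the cyclic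
    word XYUZW, where a block U separates the two pairs on one side only. *)
Definition defect X Y U Z W :=
  D X Y (U ++ Z ++ W) - D X Y (U ++ W ++ Z)
  - (D Z W (X ++ Y ++ U) - D Z W (Y ++ X ++ U)).

(** Apply the four-block square to X, YU, Z, W and carry X across Y and U one
    after the other: the square splits into two, whose defects are those of the
    two sides, and its own defect is zero. *)
Lemma defect_rot X Y U Z W : defect X Y U Z W = defect Z W Y X U.
Proof.
have := D_square4 X (Y ++ U) Z W; rewrite !D_split_snd -!catA => h.
by rewrite /defect; zcombine h.
Qed.

Lemma D_split_fst W X Y Z : D (X ++ Y) W Z = D X W (Y ++ Z) + D Y W (Z ++ X).
Proof.
by rewrite D_swap12 D_split_snd !(D_swap12 _ W) opprD !opprK.
Qed.

(** Carry the block AB once around ECU. By D_turn this is free, and so is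
    carrying B and then A around the rest separately. The two paths differ by
    three elementary squares; two of their defects cancel by defect_rot, so that
    the third one vanishes. *)
Lemma defect0 B C U A E : defect B C U A E = 0.
Proof.
have r := defect_rot A E C B U.
have h1 := D_turn (A ++ B) E C U.
have h2 := D_turn A E C (U ++ B); have h3 := D_turn B E C (U ++ A).
rewrite !D_split_fst -!catA in h1; rewrite D_split_snd -!catA in h2.
rewrite D_split_snd -!catA (D_swap12 A B) in h3.
rewrite /defect in r *.
zcombine (eqD (eqB (eqD h2 h3) h1) r).
Qed.

(** The cost of bringing P ++ w, as a cyclic word, to P ++ L by extending the
    sorted prefix P one letter at a time: if w is XyY and y is the next letter,
    the block X is exchanged with yY, which turns P X y Y into Py Y X. *)
Fixpoint sorting L P w : V :=
  if L is y :: L' then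
    let i := index y w in
    D P (take i w) (drop i w) + sorting L' (rcons P y) (drop i.+1 w ++ take i w)
  else 0.

Lemma sortingE y L P X Y : y \notin X ->
  sorting (y :: L) P (X ++ y :: Y)
  = D P X (y :: Y) + sorting L (rcons P y) (Y ++ X).
Proof.
move=> yX /=; rewrite index_cat (negPf yX) /= eqxx addn0.
rewrite take_size_cat // drop_size_cat // -cat_rcons.
by rewrite drop_size_cat // size_rcons.
Qed.

Arguments sorting : simpl never.

(** The induction step of sorting_swap when the next letter, at the head of U,
    lies in front of the two exchanged blocks Y and Z: sorting this letter
    before or after the exchange differs by one defect. *)
Lemma sorting_before P X U Y Z :
  D P X (U ++ Y ++ Z) - D P X (U ++ Z ++ Y)
  + (D (P ++ U) Y (Z ++ X) + D (P ++ U ++ Z) X Y) = D (P ++ X ++ U) Y Z.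
Proof.
have g := defect0 P X U Y Z; have h := D_turn Y Z X (P ++ U).
rewrite (D_swap12 (P ++ U) Y) -(D_rot (P ++ U ++ Z)) (D_swap12 X Y) in h *.
rewrite -catA in h; rewrite -(D_rot (P ++ X ++ U)).
rewrite /defect in g; zcombine (eqB g h).
Qed.

(** The induction step of sorting_swap when the next letter, at the head of U,
    lies inside the first exchanged block, here Y ++ U. Once the turns around P
    and Z are used to break up the blocks, the discrepancy is again one defect. *)
Lemma sorting_inside P X Y U Z :
  D P (X ++ Y) (U ++ Z) - D P (X ++ Z ++ Y) U
  + (D (P ++ U) Z (X ++ Y) + D (P ++ U ++ X) Y Z) = D (P ++ X) (Y ++ U) Z.
Proof.
have g := defect0 Z X Y P U; have h := D_turn Z X Y (P ++ U).
have b1 := D_turn P X (Y ++ U) Z; have b2 := D_turn P X Z (Y ++ U).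
rewrite -(D_rot (P ++ X)) -(D_rot (Y ++ U)) -(D_rot (P ++ U ++ X)).
rewrite !D_split_snd -?catA in b1 b2 *; rewrite -?catA in h.
rewrite (D_swap12 Z (P ++ U)) (D_swap12 Z Y) (D_swap12 P Z).
rewrite /defect in g; zcombine (eqD (eqB (eqB b1 b2) h) g).
Qed.

(** By induction on the letters still to be sorted. After the next letter y has
    been sorted, the exchange of Y and Z becomes an exchange of blocks in a
    shorter word, possibly up to a rotation of what follows the prefix; that is
    why the induction hypothesis is used twice, for an arbitrary prefix P. *)
Lemma sorting_swap L P X Y Z : uniq L -> perm_eq (X ++ Y ++ Z) L ->
  sorting L P (X ++ Y ++ Z) - sorting L P (X ++ Z ++ Y) = D (P ++ X) Y Z.
Proof.
elim: L P X Y Z => [|y L IH] P X Y Z.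
  move=> _ XYZ; have /eqP := perm_size XYZ.
  rewrite !size_cat !addn_eq0 !size_eq0.
  by case/and3P=> _ /eqP-> /eqP->; rewrite -D_rot D_nil subrr.
move=> /[dup] uyL /andP[_ uL] XYZ.
have pull A B : perm_eq (A ++ y :: B) (y :: L) ->
    y \notin A /\ perm_eq (B ++ A) L.
  move=> AB; have := perm_uniq AB; rewrite uyL cat_uniq /= negb_or.
  move/and3P=> [_ /andP[yA _] _]; split=> //.
  by have := AB; rewrite perm_catC cat_cons perm_cons.
have main A B C : perm_eq (A ++ B ++ C) (y :: L) -> y \in A ++ B ->
    sorting (y :: L) P (A ++ B ++ C) - sorting (y :: L) P (A ++ C ++ B)
    = D (P ++ A) B C.
  move=> + yAB; rewrite mem_cat in yAB; case/orP: yAB => /splitPr def_y.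
    (* y is in front of the exchanged blocks *)
    case: _ / def_y => A1 A2; rewrite -!catA /= => /pull[yA1].
    rewrite -!catA => pL.
    rewrite !sortingE // -!catA.
    have h1 := IH (rcons P y) A2 B (C ++ A1) uL pL.
    have h2 := IH (rcons P y) (A2 ++ C) A1 B uL.
    have h3 := sorting_before P A1 (y :: A2) B C.
    rewrite /= -?cat_rcons -?catA in h1 h2 h3 *.
    have pL' : perm_eq (A2 ++ C ++ A1 ++ B) L.
      by apply: perm_trans pL; rewrite perm_cat2l catA perm_catC.
    by rewrite -h3; zcombine (eqD h1 (h2 pL')).
  (* y is in the first exchanged block *)
  case: _ / def_y => B1 B2; rewrite -!catA /= => ABC.
  have [] := pull (A ++ B1) (B2 ++ C); rewrite -?catA // => yAB1 pL.
  have yACB1 : y \notin A ++ C ++ B1.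
    have [] // := pull (A ++ C ++ B1) B2; apply: perm_trans ABC.
    by rewrite -!catA perm_cat2l perm_catC -catA.
  have := sortingE L P (B2 ++ C) yAB1; have := sortingE L P B2 yACB1.
  rewrite -!catA => -> ->.
  have h1 := IH (rcons P y) B2 C (A ++ B1) uL pL.
  have h2 := IH (rcons P y) (B2 ++ A) B1 C uL.
  have h3 := sorting_inside P A B1 (y :: B2) C.
  rewrite /= -?cat_rcons -?catA in h1 h2 h3 *.
  have pL' : perm_eq (B2 ++ A ++ B1 ++ C) L.
    by apply: perm_trans pL; rewrite perm_cat2l catA perm_catC.
  by rewrite -h3; zcombine (eqD h1 (h2 pL')).
(* if y is in the second block, run the exchange backwards *)
have : y \in (X ++ Y) ++ Z by rewrite -catA (perm_mem XYZ) mem_head.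
rewrite mem_cat => /orP[yXY|yZ]; first exact: main.
rewrite -[RHS]opprK -D_swap -(main X Z Y) ?opprB //; last first.
  by rewrite mem_cat yZ orbT.
by apply: perm_trans XYZ; rewrite perm_cat2l perm_catC.
Qed.
End Alternating.

(** * A potential for block reversals in words *)

(** f X Y Z is the cost of passing from the word XYZ to the word ZYX, for words
    in which every letter of L occurs once; it is zero elsewhere, so that no
    identity below needs side conditions. The hypotheses f_mid and f_rel are the
    relations imposed by the second boundary map. Setting some of the words to
    be empty in f_rel shows that f [::] X Y, the cost of the rotation of XY into
    YX, is also f X [::] Y and f X Y [::], and that it is antisymmetric and
    satisfies the cocycle relation f_cycle. *)
Section Potential.
Variables (T : eqType) (V : zmodType) (L : seq T).
Implicit Types (W X Y Z P w : seq T).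

Variable f : seq T -> seq T -> seq T -> V.
Hypothesis uniq_L : uniq L.
Hypothesis f_supp : forall X Y Z, ~~ perm_eq (X ++ Y ++ Z) L -> f X Y Z = 0.
Hypothesis f_mid : forall X, f [::] X [::] = 0.
Hypothesis f_rel : forall X Y Z W,
  f (X ++ Y) Z W + f W (Z ++ X) Y + f (Y ++ Z ++ X) [::] W + f W (Y ++ Z) X = 0.

Lemma f_left X : f X [::] [::] = 0.
Proof.
by have := f_rel [::] [::] X [::]; rewrite !f_mid /= !cats0 => h; zcombine h.
Qed.

Lemma f_anti X Y : f [::] Y X = - f [::] X Y.
Proof.
by have := f_rel X Y [::] [::]; rewrite /= cats0 !f_left => h; zcombine h.
Qed.

Lemma f_nil3 X Y : f X Y [::] = f [::] X Y.
Proof.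
have := f_rel X [::] Y [::]; rewrite /= cats0 f_mid f_left (f_anti X) => h.
zcombine h.
Qed.

Lemma f_nil2 X Y : f X [::] Y = f [::] X Y.
Proof.
have := f_rel [::] [::] X Y; rewrite /= cats0 !f_nil3 (f_anti X) => h.
zcombine h.
Qed.

Lemma f_cycle X Y Z :
  f [::] (X ++ Y) Z + f [::] (Z ++ X) Y + f [::] (Y ++ Z) X = 0.
Proof.
have := f_rel X Y Z [::]; rewrite f_nil3 f_left => h; zcombine h.
Qed.

(** The cost of rotating w so that it begins with x. *)
Definition cut_at x w := f [::] (take (index x w) w) (drop (index x w) w).

Lemma cut_atE x X Y : x \notin X -> cut_at x (X ++ x :: Y) = f [::] X (x :: Y).
Proof.
move=> xX; rewrite /cut_at index_cat (negPf xX) /= eqxx addn0.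
by rewrite take_size_cat ?drop_size_cat.
Qed.

Lemma cut_at_swap x X Y : uniq (X ++ Y) -> x \in X ->
  cut_at x (X ++ Y) - cut_at x (Y ++ X) = f [::] X Y.
Proof.
move=> + /splitPr def_X; case: _ / def_X => A B; rewrite -catA /= => uXY.
have xA : x \notin A.
  by move: uXY; rewrite cat_uniq /= negb_or => /and3P[_ /andP[]].
have xYA : x \notin Y ++ A.
  move: uXY; rewrite uniq_catC /= => /andP[+ _].
  by rewrite !mem_cat !negb_or => /andP[/andP[_ ->] ->].
rewrite cut_atE // catA cut_atE //.
by have h := f_cycle A (x :: B) Y; rewrite (f_anti A) /= in h; zcombine (esym h).
Qed.

Definition rotation w : V := if L is x :: _ then cut_at x w else 0.

Lemma rotation_swap X Y : rotation (X ++ Y) - rotation (Y ++ X) = f [::] X Y.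
Proof.
have [XY|nXY] := boolP (perm_eq (X ++ Y) L); last first.
  have rot0 w : perm_eq w (X ++ Y) -> rotation w = 0.
    move=> wXY; rewrite /rotation; case def_L: L => [|x L'] //.
    by rewrite /cut_at f_supp //= cat_take_drop (permPl wXY).
  by rewrite !rot0 ?f_supp ?subrr // perm_catC.
rewrite /rotation; case def_L: L => [|x L'].
  have := perm_size XY; rewrite def_L size_cat => /eqP.
  by rewrite addn_eq0 !size_eq0 => /andP[/eqP-> /eqP->]; rewrite f_mid subrr.
have uXY : uniq (X ++ Y) by rewrite (perm_uniq XY).
have : x \in X ++ Y by rewrite (perm_mem XY) def_L mem_head.
rewrite mem_cat => /orP[xX|xY]; first exact: cut_at_swap.
by rewrite -[RHS]opprK -f_anti -(@cut_at_swap x) ?opprB // uniq_catC.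
Qed.

(* Correcting f by the cost of rotations gives a cost for moves of cyclic words,
   to which the results on cyclic words apply. *)
Let F X Y Z := f X Y Z - rotation (X ++ Y ++ Z) + rotation (Z ++ Y ++ X).

Let F_nil1 X Y : F [::] X Y = 0.
Proof.
by have h := rotation_swap X Y; rewrite /F /= cats0; zcombine (esym h).
Qed.

Let F_nil2 X Y : F X [::] Y = 0.
Proof. by have h := F_nil1 X Y; rewrite -h /F /= cats0 f_nil2. Qed.

Let F_nil3 X Y : F X Y [::] = 0.
Proof.
have h := rotation_swap X Y; rewrite /F /= cats0 f_nil3.
by zcombine (esym h).
Qed.

Let F_rel X Y Z W : F (X ++ Y) Z W + F W (Z ++ X) Y + F W (Y ++ Z) X = 0.
Proof.
have := F_nil2 (Y ++ Z ++ X) W; have := f_rel X Y Z W.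
rewrite /F -!catA /= => h1 h2; zcombine (eqB h1 h2).
Qed.

Let F_rev X Y Z : F Z Y X = - F X Y Z.
Proof.
by have h := F_rel [::] X Y Z; rewrite F_nil3 cats0 /= in h; zcombine h.
Qed.

Let F_swap X Y Z : F X Z Y = - F X Y Z.
Proof.
by have h := F_rel Y Z [::] X; rewrite F_nil2 cats0 /= in h; zcombine h.
Qed.

Let F_rot X Y Z : F Y Z X = F X Y Z.
Proof. by rewrite F_rev F_swap opprK. Qed.

Let F_turn W X Y Z : F W X (Y ++ Z) + F W Y (Z ++ X) + F W Z (X ++ Y) = 0.
Proof.
have h := F_rel Y Z X W; rewrite (F_rev W) (F_swap W Z) (F_swap W Y) in h.
zcombine (esym h).
Qed.

(** A word is first rotated and then sorted as a cyclic word. *)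
Lemma potential_exists : exists s : seq T -> V,
  forall X Y Z, perm_eq (X ++ Y ++ Z) L ->
  s (X ++ Y ++ Z) - s (Z ++ Y ++ X) = f X Y Z.
Proof.
exists (fun w => sorting F L [::] w + rotation w) => X Y Z XYZ.
have h1 := sorting_swap F_rot F_swap F_turn [::] uniq_L XYZ.
have ZYX : perm_eq ([::] ++ (Z ++ Y) ++ X) L.
  by apply: perm_trans XYZ; rewrite /= perm_catC perm_cat2l perm_catC.
have h2 := sorting_swap F_rot F_swap F_turn [::] uniq_L ZYX.
rewrite F_nil1 /= -?catA in h1 h2.
have h3 : F X Y Z =
  f X Y Z - rotation (X ++ Y ++ Z) + rotation (Z ++ Y ++ X) by [].
rewrite h3 in h1; zcombine (eqB h1 h2).
Qed.
End Potential.

(** * Homology of short complexes *)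

Section Homology.
Variable k : pzRingType.

Lemma lmod_iso_trans (U V W : lmodType k) :
  lmod_iso U V -> lmod_iso V W -> lmod_iso U W.
Proof.
move=> [f fB] [g gB]; exists (g \o f : {linear U -> W}).
exact: bij_comp gB fB.
Qed.

Lemma quotmod_pi0 (U : lmodType k) (G : U -> Prop) (u : U) :
  G 0 -> (forall c x y, G x -> G y -> G (c *: x + y)) ->
  quotmod_pi G u = 0 <-> G u.
Proof.
move=> G0 GD; rewrite -(raddf0 (quotmod_pi G)) quotmod_piE subr0.
split=> [/asboolP uG|/span_gen //].
apply/asboolP/(uG (fun v => `[< G v >])) => [|v Gv]; last exact/asboolP.
split; first exact/asboolP.
by move=> c x y /asboolP Gx /asboolP Gy; apply/asboolP/GD.
Qed.

Lemma coker_pi0 (U V : lmodType k) (d : {linear V -> U}) (u : U) :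
  quotmod_pi (fun u => exists y, u = d y) u = 0 <-> exists y, u = d y.
Proof.
apply: quotmod_pi0 => [|c _ _ [x ->] [y ->]]; first by exists 0; rewrite raddf0.
by exists (c *: x + y); rewrite linearP.
Qed.

Section HomologyClass.
Variables (C0 C1 C2 : lmodType k).
Variables (c1 : {linear C1 -> C0}) (c2 : {linear C2 -> C1}).

Definition homology_pi (z : kermod c1) : homology c1 c2 := quotmod_pi _ z.

Lemma homology_pi0 (z : kermod c1) :
  homology_pi z = 0 <-> exists y, val z = c2 y.
Proof.
apply: quotmod_pi0 => [|c x y [x' xE] [y' yE]].
  by exists 0; rewrite !raddf0.
by exists (c *: x' + y'); rewrite linearP -xE -yE.
Qed.

Lemma homology_pi_eq (z z' : kermod c1) :
  (exists y, val z - val z' = c2 y) -> homology_pi z = homology_pi z'.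
Proof.
move=> zz'; apply/eqP; rewrite -subr_eq0 -raddfB.
by apply/eqP/homology_pi0.
Qed.

End HomologyClass.
Arguments homology_pi {C0 C1 C2}.

Section HomologyMap.
Variables (C0 C1 C2 D0 D1 D2 : lmodType k).
Variables (c1 : {linear C1 -> C0}) (c2 : {linear C2 -> C1}).
Variables (d1 : {linear D1 -> D0}) (d2 : {linear D2 -> D1}).
Variable f : {linear C1 -> D1}.
Hypothesis f_cycle : forall x, c1 x = 0 -> d1 (f x) = 0.
Hypothesis f_boundary : forall y, exists z, f (c2 y) = d2 z.

Definition cycle_map (z : kermod c1) : kermod d1 :=
  Kermod (in_ker (f_cycle (kermod0 z))).

Lemma cycle_map_linear : linear cycle_map.
Proof. by move=> c x y; apply: val_inj; rewrite /= linearP. Qed.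

HB.instance Definition _ :=
  GRing.isLinear.Build k (kermod c1) (kermod d1) *:%R cycle_map cycle_map_linear.

Lemma homology_map_subproof (z : kermod c1) : (exists y : C2, val z = c2 y) ->
  (homology_pi d1 d2 \o cycle_map) z = 0.
Proof.
move=> [y zE]; apply/homology_pi0; rewrite /= zE; exact: f_boundary.
Qed.

Definition homology_map : {linear homology c1 c2 -> homology d1 d2} :=
  quotmod_lift homology_map_subproof.

Lemma homology_mapE (z : kermod c1) :
  homology_map (homology_pi c1 c2 z) = homology_pi d1 d2 (cycle_map z).
Proof. exact: quotmod_liftE. Qed.

End HomologyMap.

(** Only the maps in the middle degree matter: maps that preserve cycles and
    boundaries and are mutually inverse on cycles up to boundaries. *)
Lemma homology_iso (C0 C1 C2 D0 D1 D2 : lmodType k)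
    (c1 : {linear C1 -> C0}) (c2 : {linear C2 -> C1})
    (d1 : {linear D1 -> D0}) (d2 : {linear D2 -> D1})
    (f : {linear C1 -> D1}) (g : {linear D1 -> C1}) :
  (forall x, c1 x = 0 -> d1 (f x) = 0) ->
  (forall y, exists z, f (c2 y) = d2 z) ->
  (forall x, d1 x = 0 -> c1 (g x) = 0) ->
  (forall y, exists z, g (d2 y) = c2 z) ->
  (forall x, c1 x = 0 -> exists y, g (f x) - x = c2 y) ->
  (forall x, d1 x = 0 -> exists y, f (g x) - x = d2 y) ->
  lmod_iso (homology c1 c2) (homology d1 d2).
Proof.
move=> f1 f2 g1 g2 gf fg; exists (homology_map f1 f2).
exists (homology_map g1 g2) => q; rewrite -[q]quotmod_reprK.
  transitivity
    (homology_pi c1 c2 (cycle_map g1 (cycle_map f1 (quotmod_repr q)))).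
    by rewrite -(homology_mapE g1 g2) -(homology_mapE f1 f2).
  by apply/homology_pi_eq/gf/kermod0.
transitivity (homology_pi d1 d2 (cycle_map f1 (cycle_map g1 (quotmod_repr q)))).
  by rewrite -(homology_mapE f1 f2) -(homology_mapE g1 g2).
by apply/homology_pi_eq/fg/kermod0.
Qed.

End Homology.

(** * Comparison of partial projective resolutions *)

Section Comparison.
Variable k : pzRingType.
Implicit Types F G H P M : contra_functor k.

Definition nt_id F : nat_trans F F :=
  @NatTrans k F F (fun n => idfun) (fun _ _ _ _ => erefl).

Lemma nt_sub_natural F G (f g : nat_trans F G) n m (a : DS n m) (x : F m) :
  (f n \- g n) (cf_map F a x) = cf_map G a ((f m \- g m) x).
Proof. by rewrite /= !nt_natural raddfB. Qed.

Definition nt_sub F G (f g : nat_trans F G) : nat_trans F G :=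
  @NatTrans k F G (fun n => f n \- g n) (nt_sub_natural f g).

Section Corestriction.
Variables (F G H : contra_functor k) (u : nat_trans G H) (v : nat_trans F G).
Hypothesis uv0 : forall n x, u n (v n x) = 0.

Definition corestr_fun n (x : F n) : kermod (u n) := Kermod (in_ker (uv0 x)).

Lemma corestr_linear n : linear (@corestr_fun n).
Proof. by move=> c x y; apply: val_inj; rewrite /= linearP. Qed.

HB.instance Definition _ n :=
  GRing.isLinear.Build k (F n) (kermod (u n)) *:%R (@corestr_fun n)
    (@corestr_linear n).

Lemma corestr_natural n m (a : DS n m) (x : F m) :
  corestr_fun (cf_map F a x) = cf_map (kerf u) a (corestr_fun x).
Proof. by apply: val_inj; rewrite /= nt_natural. Qed.

Definition corestr : nat_trans F (kerf u) :=
  @NatTrans k F (kerf u) (fun n => @corestr_fun n) corestr_natural.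
End Corestriction.

(** The basic lifting property: a map from a projective P into the cycles of an
    exact sequence factors through the preceding term. Projectivity is applied
    to the corestriction of v to the kernel of u. *)
Lemma projective_lift F G H P (u : nat_trans G H) (v : nat_trans F G)
    (f : nat_trans P G) :
  projective P -> (forall n x, u n x = 0 <-> exists y, x = v n y) ->
  (forall n x, u n (f n x) = 0) ->
  exists h : nat_trans P F, forall n x, v n (h n x) = f n x.
Proof.
move=> P_proj uv uf0.
have uv0 n x : u n (v n x) = 0 by apply/uv; exists x.
have epi : nt_epi (corestr uv0).
  move=> n z; have [y yE] := (uv n (val z)).1 (kermod0 z).
  by exists y; apply: val_inj.
have [h hE] := P_proj _ _ _ (corestr uf0) epi.
by exists h => n x; rewrite -[RHS]/(val (corestr uf0 n x)) -hE.
Qed.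

(** Three projective terms, exact at the first two: by the comparison theorem
    this already determines the derived functors in degrees 0 and 1. *)
Record partial_resolution M := PartialResolution {
  pr0 : contra_functor k;
  pr1 : contra_functor k;
  pr2 : contra_functor k;
  pr_d0 : nat_trans pr1 pr0;
  pr_d1 : nat_trans pr2 pr1;
  pr_aug : nat_trans pr0 M;
  pr0_projective : projective pr0;
  pr1_projective : projective pr1;
  pr2_projective : projective pr2;
  pr_aug_epi : nt_epi pr_aug;
  pr_exact0 : forall n x, pr_aug n x = 0 <-> exists y, x = pr_d0 n y;
  pr_exact1 : forall n x, pr_d0 n x = 0 <-> exists y, x = pr_d1 n y
}.

Definition truncation M (P : projective_resolution M) : partial_resolution M :=
  PartialResolution (@res_projective _ _ P 0) (@res_projective _ _ P 1)
    (@res_projective _ _ P 2) (@res_aug_epi _ _ P) (@res_exact0 _ _ P)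
    (@res_exact _ _ P 0).

Lemma chain_map_exists M (C D : partial_resolution M) :
  exists (f0 : nat_trans (pr0 C) (pr0 D)) (f1 : nat_trans (pr1 C) (pr1 D))
         (f2 : nat_trans (pr2 C) (pr2 D)),
  [/\ forall n x, pr_aug D n (f0 n x) = pr_aug C n x,
      forall n x, pr_d0 D n (f1 n x) = f0 n (pr_d0 C n x) &
      forall n x, pr_d1 D n (f2 n x) = f1 n (pr_d1 C n x)].
Proof.
have [f0 f0E] := pr0_projective (pr_aug C) (@pr_aug_epi _ D).
have [f1 f1E] : exists f1 : nat_trans (pr1 C) (pr1 D),
    forall n x, pr_d0 D n (f1 n x) = nt_comp f0 (pr_d0 C) n x.
  apply: projective_lift (@pr1_projective _ C) (@pr_exact0 _ D) _ => n x /=.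
  by rewrite f0E; apply/pr_exact0; exists x.
have [f2 f2E] : exists f2 : nat_trans (pr2 C) (pr2 D),
    forall n x, pr_d1 D n (f2 n x) = nt_comp f1 (pr_d1 C) n x.
  apply: projective_lift (@pr2_projective _ C) (@pr_exact1 _ D) _ => n x /=.
  rewrite f1E /= (_ : pr_d0 C n _ = 0) ?raddf0 //.
  by apply/pr_exact1; exists x.
by exists f0, f1, f2; split.
Qed.

(** A chain endomorphism over the identity of M is homotopic to the identity, in
    the degrees where the resolution is exact. *)
Lemma homotopy_exists M (C : partial_resolution M)
    (f0 : nat_trans (pr0 C) (pr0 C)) (f1 : nat_trans (pr1 C) (pr1 C)) :
  (forall n x, pr_aug C n (f0 n x) = pr_aug C n x) ->
  (forall n x, pr_d0 C n (f1 n x) = f0 n (pr_d0 C n x)) ->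
  exists (h0 : nat_trans (pr0 C) (pr1 C)) (h1 : nat_trans (pr1 C) (pr2 C)),
    (forall n x, pr_d0 C n (h0 n x) = f0 n x - x) /\
    (forall n x, pr_d1 C n (h1 n x) = f1 n x - x - h0 n (pr_d0 C n x)).
Proof.
move=> f0E f1E.
have [h0 h0E] : exists h0 : nat_trans (pr0 C) (pr1 C),
    forall n x, pr_d0 C n (h0 n x) = nt_sub f0 (nt_id _) n x.
  apply: projective_lift (@pr0_projective _ C) (@pr_exact0 _ C) _ => n x.
  by rewrite /= raddfB /= f0E subrr.
have [h1 h1E] : exists h1 : nat_trans (pr1 C) (pr2 C),
    forall n x, pr_d1 C n (h1 n x)
      = nt_sub (nt_sub f1 (nt_id _)) (nt_comp h0 (pr_d0 C)) n x.
  apply: projective_lift (@pr1_projective _ C) (@pr_exact1 _ C) _ => n x.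
  by rewrite /= !raddfB /= f1E h0E /= subrr.
by exists h0, h1.
Qed.

End Comparison.

Section TensorComparison.
Variable k : comPzRingType.

Section Tensor.
Variable N : co_functor k.

Lemma tens_ext (M : contra_functor k) (W : lmodType k)
    (f g : {linear tensDS M N -> W}) :
  (forall n (y : M n) (x : N n), f (tens_pure y x) = g (tens_pure y x)) ->
  f =1 g.
Proof.
move=> fg q; rewrite -[q]quotmod_reprK.
apply: (@free_ext _ _ _ (f \o quotmod_pi _) (g \o quotmod_pi _)).
by case=> n [y x]; apply: fg.
Qed.

Lemma tens_pureD (M : contra_functor k) n (y y' : M n) (x : N n) :
  tens_pure (y + y') x = tens_pure y x + tens_pure y' x.
Proof. by have := tens_pureDl 1 y y' x; rewrite !scale1r. Qed.

Lemma tens_pureB (M : contra_functor k) n (y y' : M n) (x : N n) :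
  tens_pure (y - y') x = tens_pure y x - tens_pure y' x.
Proof. by rewrite addrC -scaleN1r tens_pureDl scaleN1r addrC. Qed.

Variable M : contra_functor k.
Implicit Types C D : partial_resolution M.

Definition pr_homology0 C : lmodType k :=
  homology (\0 : {linear tensDS (pr0 C) N -> zeromod k}) (tens_map (pr_d0 C) N).
Definition pr_homology1 C : lmodType k :=
  homology (tens_map (pr_d0 C) N) (tens_map (pr_d1 C) N).

(** The homotopy between the round trip from C to D and back and the identity
    survives tensoring, although exactness does not. *)
Lemma tens_round_trip C D
  (f0 : nat_trans (pr0 C) (pr0 D)) (g0 : nat_trans (pr0 D) (pr0 C))
  (f1 : nat_trans (pr1 C) (pr1 D)) (g1 : nat_trans (pr1 D) (pr1 C)) :
  (forall n x, pr_aug D n (f0 n x) = pr_aug C n x) ->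
  (forall n x, pr_aug C n (g0 n x) = pr_aug D n x) ->
  (forall n x, pr_d0 D n (f1 n x) = f0 n (pr_d0 C n x)) ->
  (forall n x, pr_d0 C n (g1 n x) = g0 n (pr_d0 D n x)) ->
  (forall t, exists y,
     tens_map g0 N (tens_map f0 N t) - t = tens_map (pr_d0 C) N y) /\
  (forall t, tens_map (pr_d0 C) N t = 0 -> exists y,
     tens_map g1 N (tens_map f1 N t) - t = tens_map (pr_d1 C) N y).
Proof.
move=> f0E g0E f1E g1E.
have [||h0 [h1 [h0E h1E]]] :=
    @homotopy_exists _ _ C (nt_comp g0 f0) (nt_comp g1 f1) => [n x|n x|] /=.
- by rewrite g0E f0E.
- by rewrite g1E f1E.
split=> [t|t t0].
  exists (tens_map h0 N t).
  apply: (tens_ext (f := (tens_map g0 N \o tens_map f0 N) \- idfun)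
                   (g := tens_map (pr_d0 C) N \o tens_map h0 N)) => n y x.
  change (tens_map g0 N (tens_map f0 N (tens_pure y x)) - tens_pure y x
          = tens_map (pr_d0 C) N (tens_map h0 N (tens_pure y x))).
  by rewrite !tens_mapE h0E tens_pureB.
exists (tens_map h1 N t).
rewrite -[LHS]subr0 -(raddf0 (tens_map h0 N)) -t0.
apply: (tens_ext (f := ((tens_map g1 N \o tens_map f1 N) \- idfun)
                       \- (tens_map h0 N \o tens_map (pr_d0 C) N))
                 (g := tens_map (pr_d1 C) N \o tens_map h1 N)) => n y x.
change (tens_map g1 N (tens_map f1 N (tens_pure y x)) - tens_pure y x
        - tens_map h0 N (tens_map (pr_d0 C) N (tens_pure y x))
        = tens_map (pr_d1 C) N (tens_map h1 N (tens_pure y x))).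
by rewrite !tens_mapE h1E !tens_pureB.
Qed.

Lemma pr_homology_iso C D :
  lmod_iso (pr_homology0 C) (pr_homology0 D) /\
  lmod_iso (pr_homology1 C) (pr_homology1 D).
Proof.
have [f0 [f1 [f2 [f0E f1E f2E]]]] := chain_map_exists C D.
have [g0 [g1 [g2 [g0E g1E g2E]]]] := chain_map_exists D C.
have [gf0 gf1] := tens_round_trip f0E g0E f1E g1E.
have [fg0 fg1] := tens_round_trip g0E f0E g1E f1E.
have comm (F G H K : contra_functor k) (u : nat_trans F G) (v : nat_trans G H)
    (u' : nat_trans F K) (v' : nat_trans K H) :
    (forall n x, v n (u n x) = v' n (u' n x)) -> forall t,
    tens_map v N (tens_map u N t) = tens_map v' N (tens_map u' N t).
  move=> E; apply: (tens_ext (f := tens_map v N \o tens_map u N)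
    (g := tens_map v' N \o tens_map u' N)) => n y x.
  change (tens_map v N (tens_map u N (tens_pure y x))
          = tens_map v' N (tens_map u' N (tens_pure y x))).
  by rewrite !tens_mapE E.
split.
  apply: (homology_iso (f := tens_map f0 N) (g := tens_map g0 N)) => //.
  - by move=> y; exists (tens_map f1 N y); apply/esym/comm.
  - by move=> y; exists (tens_map g1 N y); apply/esym/comm.
apply: (homology_iso (f := tens_map f1 N) (g := tens_map g1 N)) => //.
- by move=> x x0; rewrite (comm _ _ _ _ _ _ _ _ f1E) x0 raddf0.
- by move=> y; exists (tens_map f2 N y); apply/esym/comm.
- by move=> x x0; rewrite (comm _ _ _ _ _ _ _ _ g1E) x0 raddf0.
- by move=> y; exists (tens_map g2 N y); apply/esym/comm.
Qed.

End Tensor.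
End TensorComparison.

(** * Morphisms as lists of words *)

(** A morphism from [n] to [m] is the list of its m + 1 fibers, that is, a list
    of words in which every letter of [n] occurs exactly once. *)
Section Words.
Implicit Types n m : nat.

Lemma mem_nth_flatten (T : eqType) (ws : seq (seq T)) i x :
  x \in nth [::] ws i -> x \in flatten ws.
Proof.
move=> xi; apply/flattenP; exists (nth [::] ws i) => //; apply: mem_nth.
by rewrite ltnNge; apply: contraTN xi => /(nth_default [::])->.
Qed.

Lemma uniq_nth_flatten (T : eqType) (ws : seq (seq T)) i :
  uniq (flatten ws) -> uniq (nth [::] ws i).
Proof.
elim: ws i => [|w ws IH] [|i] //=; rewrite cat_uniq => /and3P[] // _ _.
exact: IH.
Qed.

Lemma uniq_flatten_inj (T : eqType) (ws : seq (seq T)) x i j :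
  uniq (flatten ws) -> x \in nth [::] ws i -> x \in nth [::] ws j -> i = j.
Proof.
elim: ws i j => [|w ws IH] [|i] [|j] //=; rewrite cat_uniq;
  move=> /and3P[_ /hasPn disj uws] xi xj.
- by have := disj x (mem_nth_flatten xj); rewrite xi.
- by have := disj x (mem_nth_flatten xi); rewrite xj.
- by rewrite (IH i j).
Qed.

Lemma ds_of_words n m (ws : seq (seq 'I_n.+1)) :
  size ws = m.+1 -> perm_eq (flatten ws) (enum 'I_n.+1) ->
  exists a : DS n m, forall j : 'I_m.+1, ds_fib a j = nth [::] ws j.
Proof.
move=> sz_ws ws_perm.
have uws : uniq (flatten ws) by rewrite (perm_uniq ws_perm) enum_uniq.
pose pos i := find (fun w : seq 'I_n.+1 => i \in w) ws.
have has_i i : has (fun w : seq 'I_n.+1 => i \in w) ws.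
  have : i \in flatten ws by rewrite (perm_mem ws_perm) mem_enum.
  by case/flattenP => w ws_w iw; apply/hasP; exists w.
have pos_lt i : (pos i < m.+1)%N by rewrite -sz_ws -has_find.
have mem_pos i : i \in nth [::] ws (pos i).
  exact: (nth_find [::] (has_i i)).
have vP : @is_DS n m ([ffun i => Ordinal (pos_lt i)],
                     [ffun j : 'I_m.+1 => nth [::] ws j]).
  apply/forallP => j; rewrite !ffunE uniq_nth_flatten //=.
  apply/forallP => i; rewrite ffunE; apply/eqP; apply/idP/eqP => [ij|<- //].
  by apply: val_inj; apply: uniq_flatten_inj uws (mem_pos i) ij.
by exists (MkDS vP) => j; rewrite /ds_fib /= ffunE.
Qed.

Definition ds_words n m (a : DS n m) := [seq ds_fib a j | j <- enum 'I_m.+1].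

Lemma nth_ds_words n m (a : DS n m) (j : 'I_m.+1) :
  nth [::] (ds_words a) j = ds_fib a j.
Proof. by rewrite (nth_map j) ?nth_ord_enum // size_enum_ord. Qed.

Lemma perm_ds_words n m (a : DS n m) :
  perm_eq (flatten (ds_words a)) (enum 'I_n.+1).
Proof.
(* composing with a morphism to [0] concatenates the fibers *)
have [|c cE] := @ds_of_words m 0 [:: enum 'I_m.+1] erefl.
  by rewrite /= cats0.
have E : ds_fib (ds_comp c a) ord0 = flatten (ds_words a).
  by rewrite ds_comp_fibE cE.
apply: uniq_perm; [by rewrite -E ds_fib_uniq|exact: enum_uniq|] => i.
by rewrite -E mem_ds_fib mem_enum; apply/eqP; apply: ord1.
Qed.

End Words.

(** * Sums of representable functors *)

(** rep k m is the direct sum over I of the functors k[DS(-, [m i])]. *)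
Section Representable.
Variable k : pzRingType.
Variables (I : choiceType) (m : I -> nat).

Definition rep_gen (p : nat) : choiceType := {i : I & DS p (m i)}.
Definition rep_key p i (a : DS p (m i)) : freemod k (rep_gen p) :=
  free_gen k (Tagged (fun i => DS p (m i)) a).
Definition rep_obj (p : nat) : lmodType k := freemod k (rep_gen p).

Definition rep_map q p (b : DS q p) : {linear rep_obj p -> rep_obj q} :=
  free_lift (fun g : rep_gen p => rep_key (ds_comp (tagged g) b)).

Lemma rep_mapE q p (b : DS q p) i (a : DS p (m i)) :
  rep_map b (rep_key a) = rep_key (ds_comp a b).
Proof. exact: free_liftE. Qed.

Lemma rep_ext p (W : lmodType k) (f g : {linear rep_obj p -> W}) :
  (forall i (a : DS p (m i)), f (rep_key a) = g (rep_key a)) -> f =1 g.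
Proof. by move=> fg; apply: free_ext => -[i a]; apply: fg. Qed.

Lemma rep_id p (u : rep_obj p) : rep_map (ds_id p) u = u.
Proof.
apply: (rep_ext (f := rep_map (ds_id p)) (g := idfun)) => i a.
by rewrite [LHS]rep_mapE ds_comp_id.
Qed.

Lemma rep_comp p q r (b : DS q r) (a : DS p q) (u : rep_obj r) :
  rep_map (ds_comp b a) u = rep_map a (rep_map b u).
Proof.
apply: (rep_ext (f := rep_map (ds_comp b a)) (g := rep_map a \o rep_map b)).
move=> i c; rewrite rep_mapE -[RHS]/(rep_map a (rep_map b (rep_key c))).
by rewrite !rep_mapE ds_compA.
Qed.

Definition rep : contra_functor k := ContraFunctor rep_id rep_comp.

Section Yoneda.
Variables (F : contra_functor k) (e : forall i, F (m i)).

Definition yoneda_fun p : {linear rep p -> F p} :=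
  free_lift (fun g : rep_gen p => cf_map F (tagged g) (e (tag g))).

Lemma yoneda_funE p i (a : DS p (m i)) :
  yoneda_fun p (rep_key a) = cf_map F a (e i).
Proof. exact: free_liftE. Qed.

Lemma yoneda_natural q p (b : DS q p) (u : rep p) :
  yoneda_fun q (cf_map rep b u) = cf_map F b (yoneda_fun p u).
Proof.
apply: (rep_ext (f := yoneda_fun q \o rep_map b)
                (g := cf_map F b \o yoneda_fun p)).
move=> i a; rewrite -[LHS]/(yoneda_fun q (rep_map b (rep_key a))).
rewrite -[RHS]/(cf_map F b (yoneda_fun p (rep_key a))).
by rewrite rep_mapE !yoneda_funE cf_comp.
Qed.

Definition yoneda : nat_trans rep F := NatTrans yoneda_natural.

Lemma yonedaE p i (a : DS p (m i)) : yoneda p (rep_key a) = cf_map F a (e i).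
Proof. exact: yoneda_funE. Qed.

End Yoneda.

Lemma rep_projective : projective rep.
Proof.
move=> F G e f e_epi.
have [s sP] : {s : forall i, F (m i) &
    forall i, e (m i) (s i) = f (m i) (rep_key (ds_id (m i)))}.
  have H i := cid (e_epi (m i) (f (m i) (rep_key (ds_id (m i))))).
  by exists (fun i => projT1 (H i)) => i; apply: (projT2 (H i)).
exists (yoneda s) => p.
apply: (rep_ext (f := e p \o yoneda s p) (g := f p)) => i a.
rewrite -[LHS]/(e p (yoneda s p (rep_key a))) yonedaE nt_natural sP -nt_natural.
by rewrite [X in f p X]rep_mapE ds_id_comp.
Qed.

(** The generator of the i-th summand given by a list of words, extended by zero
    to the lists in which some letter is missing or repeated, so that the
    boundary of a triple and the relations between the classes of triples hold
    without side conditions. *)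
Definition words_elt n i (ws : seq (seq 'I_n.+1)) : rep n :=
  if pselect (exists a : DS n (m i),
                forall j : 'I_(m i).+1, ds_fib a j = nth [::] ws j) is left h
  then rep_key (projT1 (cid h)) else 0.

Lemma words_eltE n i (a : DS n (m i)) ws :
  (forall j : 'I_(m i).+1, ds_fib a j = nth [::] ws j) ->
  words_elt i ws = rep_key a.
Proof.
move=> aE; rewrite /words_elt; case: pselect => [h|[]]; last by exists a.
by congr rep_key; apply: ds_eqP => j; rewrite (projT2 (cid h)) aE.
Qed.

Lemma words_nperm n i (ws : seq (seq 'I_n.+1)) : size ws = (m i).+1 ->
  ~~ perm_eq (flatten ws) (enum 'I_n.+1) -> words_elt i ws = 0.
Proof.
move=> sz_ws; rewrite /words_elt; case: pselect => // -[a aE] /negP[].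
suff -> : ws = ds_words a by apply: perm_ds_words.
apply: (@eq_from_nth _ [::]) => [|j]; first by rewrite size_map size_enum_ord.
by rewrite sz_ws => jm; rewrite (nth_ds_words a (Ordinal jm)) aE.
Qed.

Lemma words_comp n p i (b : DS n p) (ws : seq (seq 'I_p.+1)) :
  size ws = (m i).+1 -> perm_eq (flatten ws) (enum 'I_p.+1) ->
  cf_map rep b (words_elt i ws)
  = words_elt i [seq flatten [seq ds_fib b x | x <- w] | w <- ws].
Proof.
move=> sz_ws /(ds_of_words sz_ws)[a aE]; rewrite (words_eltE aE) [LHS]rep_mapE.
apply/esym/words_eltE => j; rewrite ds_comp_fibE aE (nth_map [::]) //.
by rewrite sz_ws.
Qed.

End Representable.

Section TensorRepresentable.

Section TensorLinear.
Variables (k : comPzRingType) (M : contra_functor k) (N : co_functor k).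
Variables (n : nat) (x : N n).

Definition tens_purel (y : M n) : tensDS M N := tens_pure y x.

Lemma tens_purel_linear : linear tens_purel.
Proof. by move=> c y z; apply: tens_pureDl. Qed.

HB.instance Definition _ :=
  GRing.isLinear.Build k (M n) (tensDS M N) *:%R tens_purel tens_purel_linear.
End TensorLinear.

Variable k : comPzRingType.
Variables (I : choiceType) (m : I -> nat) (N : co_functor k).

(** coev and rep_ev below express the isomorphism between the tensor product of
    rep k m with N and the direct sum of the N (m i): tensor with the universal
    element of a summand, and evaluate. *)
Definition coev i (x : N (m i)) : tensDS (rep k m) N :=
  tens_pure (rep_key k (ds_id (m i)) : rep k m (m i)) x.

Lemma coev_linear i : linear (@coev i).
Proof. by move=> c x y; apply: tens_pureDr. Qed.

HB.instance Definition _ i :=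
  GRing.isLinear.Build k (N (m i)) (tensDS (rep k m) N) *:%R (@coev i)
    (@coev_linear i).

Lemma tens_pure_rep n i (a : DS n (m i)) (x : N n) :
  tens_pure (rep_key k a : rep k m n) x = coev (co_map N a x).
Proof.
rewrite /coev tens_pureDS; congr (tens_pure _ x).
by rewrite [RHS]rep_mapE ds_id_comp.
Qed.

Lemma tens_yoneda_coev (F : contra_functor k) (e : forall i, F (m i)) i
    (x : N (m i)) :
  tens_map (yoneda e) N (coev x) = tens_pure (e i) x.
Proof.
rewrite /coev tens_mapE; congr (tens_pure _ x).
by rewrite yonedaE cf_id.
Qed.

Lemma tens_rep_ext (W : lmodType k) (f g : {linear tensDS (rep k m) N -> W}) :
  (forall i x, f (@coev i x) = g (coev x)) -> f =1 g.
Proof.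
move=> fg; apply: tens_ext => n y x; move: y.
pose F := f \o tens_purel x : {linear rep k m n -> W}.
pose G := g \o tens_purel x : {linear rep k m n -> W}.
apply: (rep_ext (f := F) (g := G)) => i a.
by rewrite /= /tens_purel !tens_pure_rep fg.
Qed.

Section Evaluation.
Variables (W : lmodType k) (phi : forall i, {linear N (m i) -> W}).

Definition rep_ev_at n (x : N n) : {linear rep_obj k m n -> W} :=
  free_lift (fun h : rep_gen m n => phi (tag h) (co_map N (tagged h) x)).

Lemma rep_ev_atE n (x : N n) i (a : DS n (m i)) :
  rep_ev_at x (rep_key k a) = phi i (co_map N a x).
Proof. exact: free_liftE. Qed.

Definition rep_ev_gen (g : tens_gen (rep k m) N) : W :=
  rep_ev_at (tagged g).2 (tagged g).1.

Lemma rep_ev_genE n (y : rep k m n) (x : N n) :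
  free_lift rep_ev_gen (tens_key y x) = rep_ev_at x y.
Proof. exact: free_liftE. Qed.

Lemma rep_ev_atDr n (y : rep k m n) c (x x' : N n) :
  rep_ev_at (c *: x + x') y = c *: rep_ev_at x y + rep_ev_at x' y.
Proof.
rewrite /= /free_lift_fun scaler_sumr -big_split; apply: eq_bigr => h _ /=.
by rewrite !linearP.
Qed.

Lemma rep_ev_at_map n p (a : DS n p) (y : rep k m p) (x : N n) :
  rep_ev_at (co_map N a x) y = rep_ev_at x (cf_map (rep k m) a y).
Proof.
apply: (rep_ext (f := rep_ev_at (co_map N a x))
                (g := rep_ev_at x \o rep_map k m a)).
move=> i b; rewrite -[RHS]/(rep_ev_at x (rep_map k m a (rep_key k b))).
by rewrite rep_mapE !rep_ev_atE co_comp.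
Qed.

Lemma rep_ev_rel g : tens_rel g -> free_lift rep_ev_gen g = 0.
Proof.
case=> [n c y y' x|n c y x x'|n p a y x]; rewrite linearB;
  apply/eqP; rewrite subr_eq0; apply/eqP; rewrite ?linearD ?linearZ_LR;
  apply: etrans (rep_ev_genE _ _) _; apply: esym.
- apply: etrans (esym (linearP (rep_ev_at x) c y y')).
  exact: congr2 (congr1 _ (rep_ev_genE _ _)) (rep_ev_genE _ _).
- apply: etrans (esym (rep_ev_atDr y c x x')).
  exact: congr2 (congr1 _ (rep_ev_genE _ _)) (rep_ev_genE _ _).
- exact: etrans (rep_ev_genE _ _) (esym (rep_ev_at_map a y x)).
Qed.

Definition rep_ev : {linear tensDS (rep k m) N -> W} := quotmod_lift rep_ev_rel.

Lemma rep_evE i (x : N (m i)) : rep_ev (coev x) = phi i x.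
Proof.
by rewrite /coev /tens_pure [LHS]quotmod_liftE rep_ev_genE rep_ev_atE co_id.
Qed.
End Evaluation.

End TensorRepresentable.

(** * A small partial resolution of the constant functor *)

(** In the objects below, [n] is an alphabet: K0 is spanned by the words in
    which every letter occurs once, K1 by the triples (X, Y, Z) whose
    concatenation is such a word, K2 by quadruples and by words. The boundary
    maps are determined by the universal triple (0, 1, 2), the universal
    quadruple (0, 1, 2, 3) and the universal word (0). *)
Section SmallResolution.
Variable k : comPzRingType.

Definition K2_arity (b : bool) : nat := if b then 3%N else 0%N.
Definition K0 : contra_functor k := rep k (fun _ : unit => 0%N).
Definition K1 : contra_functor k := rep k (fun _ : unit => 2%N).
Definition K2 : contra_functor k := rep k K2_arity.

Definition word n (X : seq 'I_n.+1) : K0 n :=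
  words_elt k (fun _ : unit => 0%N) tt [:: X].
Definition triple n (X Y Z : seq 'I_n.+1) : K1 n :=
  words_elt k (fun _ : unit => 2%N) tt [:: X; Y; Z].

Notation key0 := (@rep_key k unit (fun _ => 0%N) _ tt).
Notation key1 := (@rep_key k unit (fun _ => 2%N) _ tt).
Notation key_quad := (@rep_key k bool K2_arity _ true).
Notation key_single := (@rep_key k bool K2_arity _ false).

Notation a_ i := (@Ordinal 3 i isT).
Notation b_ i := (@Ordinal 4 i isT).

Definition swap_elt (_ : unit) : K0 2 :=
  word [:: a_ 0; a_ 1; a_ 2] - word [:: a_ 2; a_ 1; a_ 0].

Definition quad_elt : K1 3 :=
  triple [:: b_ 0; b_ 1] [:: b_ 2] [:: b_ 3]
  + triple [:: b_ 3] [:: b_ 2; b_ 0] [:: b_ 1]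
  + triple [:: b_ 1; b_ 2; b_ 0] [::] [:: b_ 3]
  + triple [:: b_ 3] [:: b_ 1; b_ 2] [:: b_ 0].

Definition single_elt : K1 0 := triple [::] [:: ord0] [::].

Definition K2_elt (b : bool) : K1 (K2_arity b) :=
  if b is true then quad_elt else single_elt.

Definition K_aug : nat_trans K0 (const_functor k) :=
  yoneda (fun _ => (1 : k^o) : const_functor k 0).
Definition K_d0 : nat_trans K1 K0 := yoneda swap_elt.
Definition K_d1 : nat_trans K2 K1 := yoneda K2_elt.

Lemma perm_enum_ord n (s : seq 'I_n) :
  perm_eq [seq val i | i <- s] (iota 0 n) -> perm_eq s (enum 'I_n).
Proof. by rewrite -val_enum_ord => /(perm_map_inj val_inj). Qed.

Lemma word_comp n p (a : DS n p) (X : seq 'I_p.+1) :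
  perm_eq X (enum 'I_p.+1) ->
  cf_map K0 a (word X) = word (flatten [seq ds_fib a x | x <- X]).
Proof. by move=> X_perm; rewrite /word [LHS]words_comp //= cats0. Qed.

Lemma triple_comp n p (a : DS n p) (X Y Z : seq 'I_p.+1) :
  perm_eq (X ++ Y ++ Z) (enum 'I_p.+1) ->
  cf_map K1 a (triple X Y Z)
  = triple (flatten [seq ds_fib a x | x <- X])
           (flatten [seq ds_fib a x | x <- Y])
           (flatten [seq ds_fib a x | x <- Z]).
Proof. by move=> XYZ; rewrite /triple [LHS]words_comp //= cats0. Qed.

Lemma word_nperm n (X : seq 'I_n.+1) :
  ~~ perm_eq X (enum 'I_n.+1) -> word X = 0.
Proof. by move=> nX; apply: words_nperm => //=; rewrite cats0. Qed.

Lemma triple_nperm n (X Y Z : seq 'I_n.+1) :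
  ~~ perm_eq (X ++ Y ++ Z) (enum 'I_n.+1) -> triple X Y Z = 0.
Proof. by move=> nX; apply: words_nperm => //=; rewrite cats0. Qed.

Lemma rep_key_word n (a : DS n 0) :
  key0 a = word (ds_fib a ord0).
Proof. by apply/esym/words_eltE => j; rewrite ord1. Qed.

Lemma rep_key_triple n (a : DS n 2) :
  key1 a
  = triple (ds_fib a (a_ 0)) (ds_fib a (a_ 1)) (ds_fib a (a_ 2)).
Proof.
apply/esym/words_eltE => -[[|[|[|//]]] jm] /=; congr ds_fib; exact: val_inj.
Qed.

Lemma perm_fib1 n (a : DS n 0) : perm_eq (ds_fib a ord0) (enum 'I_n.+1).
Proof.
by have := perm_ds_words a; rewrite /ds_words enum_ordSl enum_ord0 /= cats0.
Qed.

Lemma enum_ord3 : enum 'I_3 = [:: a_ 0; a_ 1; a_ 2].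
Proof. by apply: (inj_map val_inj); rewrite val_enum_ord. Qed.

Lemma perm_rev3 n (X Y Z s : seq 'I_n.+1) :
  perm_eq (Z ++ Y ++ X) s = perm_eq (X ++ Y ++ Z) s.
Proof. by rewrite perm_catC -catA; apply: (permPl _); rewrite perm_catCA. Qed.

Lemma perm_fib3 n (a : DS n 2) :
  perm_eq (ds_fib a (a_ 0) ++ ds_fib a (a_ 1) ++ ds_fib a (a_ 2))
    (enum 'I_n.+1).
Proof. by have := perm_ds_words a; rewrite /ds_words enum_ord3 /= cats0. Qed.

Lemma K_d0_triple n (X Y Z : seq 'I_n.+1) :
  K_d0 n (triple X Y Z) = word (X ++ Y ++ Z) - word (Z ++ Y ++ X).
Proof.
have [XYZ|nXYZ] := boolP (perm_eq (X ++ Y ++ Z) (enum 'I_n.+1)); last first.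
  rewrite triple_nperm // raddf0 !word_nperm ?subrr //.
  by rewrite perm_rev3.
have [|a aE] := @ds_of_words n 2 [:: X; Y; Z] erefl.
  by rewrite /= cats0.
rewrite /triple (words_eltE k (i := tt) aE) yonedaE /swap_elt linearB !word_comp;
  try by apply: perm_enum_ord.
by rewrite /= !aE /= !cats0.
Qed.

Lemma K_d1_quad n (a : DS n 3) : let w j := ds_fib a j in
  K_d1 n (key_quad a)
  = triple (w (b_ 0) ++ w (b_ 1)) (w (b_ 2)) (w (b_ 3))
    + triple (w (b_ 3)) (w (b_ 2) ++ w (b_ 0)) (w (b_ 1))
    + triple (w (b_ 1) ++ w (b_ 2) ++ w (b_ 0)) [::] (w (b_ 3))
    + triple (w (b_ 3)) (w (b_ 1) ++ w (b_ 2)) (w (b_ 0)).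
Proof.
move=> w; rewrite yonedaE -[K2_elt true]/quad_elt /quad_elt !linearD.
rewrite !triple_comp; try by apply: perm_enum_ord.
by rewrite /= !cats0.
Qed.

Lemma K_d1_single n (a : DS n 0) :
  K_d1 n (key_single a) = triple [::] (ds_fib a ord0) [::].
Proof.
rewrite yonedaE -[K2_elt false]/single_elt /single_elt triple_comp.
  by rewrite /= cats0.
exact: perm_enum_ord.
Qed.

Lemma K_aug_word n (X : seq 'I_n.+1) : perm_eq X (enum 'I_n.+1) ->
  K_aug n (word X) = 1.
Proof.
move=> X_perm; have [|a aE] := @ds_of_words n 0 [:: X] erefl.
  by rewrite /= cats0.
by rewrite /word (words_eltE k (i := tt) aE) [LHS]yonedaE.
Qed.

Lemma K_aug_epi : nt_epi K_aug.
Proof.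
move=> n c; exists (c *: word (enum 'I_n.+1)).
by rewrite linearZ_LR K_aug_word // [LHS]mulr1.
Qed.

Lemma K_aug_d0 n (x : K1 n) : K_aug n (K_d0 n x) = 0.
Proof.
apply: (rep_ext (f := K_aug n \o K_d0 n) (g := \0)) => -[] a.
rewrite -[LHS]/(K_aug n (K_d0 n (key1 a))) rep_key_triple.
rewrite K_d0_triple linearB.
by rewrite !K_aug_word ?subrr //; [rewrite perm_rev3|]; apply: perm_fib3.
Qed.

(** Modulo the image of K_d0, reversing XYZ into ZYX allows any letter to be
    brought to any position, so that all words become equal. *)
Lemma K_exact0 n (x : K0 n) : K_aug n x = 0 <-> exists y, x = K_d0 n y.
Proof.
split=> [x0|[y ->]]; last exact: K_aug_d0.
rewrite -coker_pi0; set G := fun _ => _; set pi := quotmod_pi G.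
have swap X Y Z : pi (word (X ++ Y ++ Z)) = pi (word (Z ++ Y ++ X)).
  by apply: quotmod_pi_rel; exists (triple X Y Z); rewrite K_d0_triple.
have sort_word L P X : perm_eq X L -> pi (word (P ++ X)) = pi (word (P ++ L)).
  elim: L P X => [|y L IH] P X XL; first by rewrite (perm_nilP XL).
  have : y \in X by rewrite (perm_mem XL) mem_head.
  move/splitPr => def_X; case: _ / def_X XL => A B XL.
  have h := swap P [::] ((y :: B) ++ A); rewrite /= -catA in h.
  rewrite swap -h -!cat_rcons; apply: IH.
  by move: XL; rewrite perm_catC /= perm_cons.
suff -> : pi x = K_aug n x *: pi (word (enum 'I_n.+1)) by rewrite x0 scale0r.
transitivity (free_lift (fun _ => pi (word (enum 'I_n.+1))) x).
  apply: (rep_ext (f := pi)) => -[] a; rewrite [RHS]free_liftE rep_key_word.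
  exact: (sort_word _ [::]) (perm_fib1 a).
rewrite /= /free_lift_fun scaler_suml; apply: eq_bigr => g _.
by congr (_ *: _); apply/esym/mulr1.
Qed.

Lemma K_d0_d1 n (x : K2 n) : K_d0 n (K_d1 n x) = 0.
Proof.
apply: (rep_ext (f := K_d0 n \o K_d1 n) (g := \0)) => -[] a.
  rewrite -[LHS]/(K_d0 n (K_d1 n (key_quad a))) K_d1_quad.
  rewrite !linearD !K_d0_triple -!catA /=.
  zmodule.
rewrite -[LHS]/(K_d0 n (K_d1 n (key_single a))) K_d1_single.
by rewrite K_d0_triple /= !cats0 subrr.
Qed.

(** In the cokernel of K_d1 the class of (X, Y, Z) is the variation of a
    potential between the words XYZ and ZYX, which are the two terms of its
    boundary. So the class of a chain is a function of its boundary, and cycles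
    are boundaries. *)
Lemma K_exact1 n (x : K1 n) : K_d0 n x = 0 <-> exists y, x = K_d1 n y.
Proof.
split=> [x0|[y ->]]; last exact: K_d0_d1.
rewrite -coker_pi0; set G := fun _ => _; set pi := quotmod_pi G.
have im0 y : pi (K_d1 n y) = 0 by apply/coker_pi0; exists y.
pose f X Y Z := pi (triple X Y Z).
have f_supp X Y Z : ~~ perm_eq (X ++ Y ++ Z) (enum 'I_n.+1) -> f X Y Z = 0.
  by move=> nXYZ; rewrite /f triple_nperm // [LHS]raddf0.
have f_mid X : f [::] X [::] = 0.
  have [XL|nX] := boolP (perm_eq X (enum 'I_n.+1)); last first.
    by rewrite f_supp ?cats0.
  have [|a aE] := @ds_of_words n 0 [:: X] erefl.
    by rewrite /= cats0.
  by rewrite -(im0 (key_single a)) K_d1_single aE.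
have f_rel X Y Z W :
  f (X ++ Y) Z W + f W (Z ++ X) Y + f (Y ++ Z ++ X) [::] W + f W (Y ++ Z) X = 0.
  have [XL|nX] := boolP (perm_eq (X ++ Y ++ Z ++ W) (enum 'I_n.+1)); last first.
    have supp U V T : perm_eq (U ++ V ++ T) (X ++ Y ++ Z ++ W) -> f U V T = 0.
      by move=> UVT; apply: f_supp; rewrite (permPl UVT).
    have YZX : perm_eq (Y ++ Z ++ X ++ W) (X ++ Y ++ Z ++ W).
      by have /permPl := perm_catCA (Y ++ Z) X W; rewrite -!catA.
    have ZXY : perm_eq (Z ++ X ++ Y ++ W) (X ++ Y ++ Z ++ W).
      by have /permPl := perm_catCA Z (X ++ Y) W; rewrite -!catA.
    by rewrite !supp ?addr0 -?catA // perm_catC -!catA.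
  have [|a aE] := @ds_of_words n 3 [:: X; Y; Z; W] erefl.
    by rewrite /= cats0.
  rewrite -(im0 (key_quad a)) K_d1_quad !aE /=.
  by rewrite /f /pi !linearD.
have [s sE] := potential_exists (enum_uniq 'I_n.+1) f_supp f_mid f_rel.
(* the potential, extended linearly, is a left inverse of the map induced by
   K_d0 on the cokernel of K_d1 *)
pose sigma := free_lift (fun g : rep_gen (fun _ : unit => 0%N) n =>
                s (ds_fib (tagged g) ord0)) : {linear K0 n -> quotmod G}.
have sigmaE X : perm_eq X (enum 'I_n.+1) -> sigma (word X) = s X.
  move=> XL; have [|a aE] := @ds_of_words n 0 [:: X] erefl.
    by rewrite /= cats0.
  by rewrite /word (words_eltE k (i := tt) aE) [LHS]free_liftE aE.
transitivity (sigma (K_d0 n x)); last by rewrite x0 raddf0.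
apply: (rep_ext (f := pi) (g := sigma \o K_d0 n)) => -[] a.
rewrite rep_key_triple -[RHS]/(sigma (K_d0 n (triple _ _ _))).
rewrite K_d0_triple linearB.
have abc := perm_fib3 a.
by rewrite !sigmaE ?sE // perm_rev3.
Qed.

Definition small_resolution : partial_resolution (const_functor k) :=
  PartialResolution (@rep_projective _ _ _) (@rep_projective _ _ _)
    (@rep_projective _ _ _) K_aug_epi K_exact0 K_exact1.

End SmallResolution.

(** * Identification with the explicit complex *)

(** Tensored with bsym A, the small resolution becomes the explicit complex: K0
    gives A, K1 gives the third tensor power, K2 the direct sum of the fourth
    tensor power and A. The evaluations ev0, ev1, ev2 are chain maps, checked on
    pure tensors; all the other facts follow because ev0 and ev1 are invertible
    and ev2 is surjective. *)
Section Identification.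
Variables (k : comPzRingType) (A : unital_algebra k).
Notation N := (bsym A).
Notation a_ i := (@Ordinal 3 i isT).
Notation b_ i := (@Ordinal 4 i isT).

Definition entry1 (t : 1.-tuple A) : A := tnth t ord0.

Lemma entry1_multilinear : multilinear entry1.
Proof. by move=> t i c x y; rewrite /entry1 !tnth_mktuple (ord1 i). Qed.

Definition tpow1_val : {linear tpow A 1 -> A} := tpow_lift entry1_multilinear.

Lemma tpow1_valE t : tpow1_val (tpure t) = tnth t ord0.
Proof. exact: tpow_liftE. Qed.

Definition tpow1_in (a : A) : tpow A 1 := tpure [tuple a].

Lemma tpow1_in_linear : linear tpow1_in.
Proof.
move=> c x y; rewrite /tpow1_in.
have E (a : A) : [tuple a] = tset [tuple 0] ord0 a.
  by apply: eq_from_tnth => i; rewrite tnth_mktuple (ord1 i) tnth0.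
by rewrite (E (_ + _)) (E x) (E y) tpure_multilinear.
Qed.
HB.instance Definition _ :=
  GRing.isLinear.Build k A (tpow A 1) *:%R tpow1_in tpow1_in_linear.

Lemma tpow1_valK : cancel tpow1_val tpow1_in.
Proof.
apply: (tpow_ext (f := tpow1_in \o tpow1_val) (g := idfun)) => t.
rewrite -[LHS]/(tpow1_in (tpow1_val (tpure t))) tpow1_valE; congr tpure.
by apply: eq_from_tnth => i; rewrite (ord1 i) tnth0.
Qed.

Lemma tpow1_inK : cancel tpow1_in tpow1_val.
Proof. by move=> a; rewrite /tpow1_in tpow1_valE tnth0. Qed.

Definition ev0 : {linear tensDS (K0 k) N -> A} :=
  rep_ev (N := N) (fun _ : unit => tpow1_val).
Definition ev1 : {linear tensDS (K1 k) N -> tpow A 3} :=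
  rep_ev (N := N) (m := fun _ : unit => 2%N)
    (fun _ : unit => idfun : {linear tpow A 3 -> tpow A 3}).

Definition inl_lin (u : tpow A 4) : (tpow A 4 * A)%type := (u, 0).
Lemma inl_lin_linear : linear inl_lin.
Proof. by move=> c x y; congr (_, _); rewrite /= scaler0 addr0. Qed.
HB.instance Definition _ :=
  GRing.isLinear.Build k (tpow A 4) (tpow A 4 * A)%type *:%R inl_lin
    inl_lin_linear.

Definition inr_lin (v : tpow A 1) : (tpow A 4 * A)%type := (0, tpow1_val v).
Lemma inr_lin_linear : linear inr_lin.
Proof.
move=> c x y; rewrite /inr_lin linearP.
by congr (_, _); rewrite /= scaler0 addr0.
Qed.
HB.instance Definition _ :=
  GRing.isLinear.Build k (tpow A 1) (tpow A 4 * A)%type *:%R inr_lin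
    inr_lin_linear.

Definition phi2 (b : bool) : {linear N (K2_arity b) -> (tpow A 4 * A)%type} :=
  if b is true then inl_lin else inr_lin.
Definition ev2 : {linear tensDS (K2 k) N -> (tpow A 4 * A)%type} := rep_ev phi2.

Definition in0 (a : A) : tensDS (K0 k) N :=
  coev (m := fun _ : unit => 0%N) (N := N) (i := tt) (tpow1_in a).
Lemma in0_linear : linear in0.
Proof. by move=> c x y; rewrite /in0 !linearP. Qed.
HB.instance Definition _ :=
  GRing.isLinear.Build k A (tensDS (K0 k) N) *:%R in0 in0_linear.

Definition in1 : {linear tpow A 3 -> tensDS (K1 k) N} :=
  (@coev k unit (fun _ => 2%N) N tt :
     {linear N 2%N -> tensDS (rep k (fun _ : unit => 2%N)) N}).

Lemma in0K : cancel in0 ev0.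
Proof. by move=> a; rewrite /in0 /ev0 rep_evE tpow1_inK. Qed.

Lemma ev0K : cancel ev0 in0.
Proof.
apply: (tens_rep_ext (f := in0 \o ev0) (g := idfun)) => -[] x.
by rewrite -[LHS]/(in0 (ev0 (coev _))) /ev0 rep_evE /in0 tpow1_valK.
Qed.

Lemma in1K : cancel in1 ev1.
Proof. by move=> x; rewrite /in1 /ev1 [LHS]rep_evE. Qed.

Lemma ev1K : cancel ev1 in1.
Proof.
apply: (tens_rep_ext (f := in1 \o ev1) (g := idfun)) => -[] x.
by rewrite -[LHS]/(in1 (ev1 (coev _))) /ev1 rep_evE.
Qed.

Lemma ev0_word n (X : seq 'I_n.+1) (t : n.+1.-tuple A) :
  perm_eq X (enum 'I_n.+1) ->
  ev0 (tens_pure (word k X) (tpure t : N n)) = \prod_(x <- X) tnth t x.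
Proof.
move=> X_perm; have [|a aE] := @ds_of_words n 0 [:: X] erefl.
  by rewrite /= cats0.
rewrite /word (words_eltE k (m := fun _ : unit => 0%N) (i := tt) aE).
rewrite [X in ev0 X]tens_pure_rep /ev0 rep_evE [X in tpow1_val X]bsym_mapE.
by rewrite tpow1_valE tnth_mktuple aE.
Qed.

Lemma ev1_triple n (X Y Z : seq 'I_n.+1) (t : n.+1.-tuple A) :
  perm_eq (X ++ Y ++ Z) (enum 'I_n.+1) ->
  ev1 (tens_pure (triple k X Y Z) (tpure t : N n))
  = tpure [tuple \prod_(x <- X) tnth t x; \prod_(x <- Y) tnth t x;
                 \prod_(x <- Z) tnth t x].
Proof.
move=> XYZ; have [|a aE] := @ds_of_words n 2 [:: X; Y; Z] erefl.
  by rewrite /= cats0.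
rewrite /triple (words_eltE k (m := fun _ : unit => 2%N) (i := tt) aE).
rewrite [X in ev1 X]tens_pure_rep /ev1 rep_evE /= [LHS]bsym_mapE.
congr tpure; apply: eq_from_tnth => j; rewrite tnth_mktuple aE.
by case: j => [[|[|[|//]]] jm]; rewrite (tnth_nth 0).
Qed.

Lemma pd1_tpure (t : 3.-tuple A) : pd1 A (tpure t) = pd1_fun t.
Proof. exact: tpow_liftE. Qed.

Lemma ev0_swap (t : 3.-tuple A) :
  ev0 (tens_pure (swap_elt k tt) (tpure t : N 2%N)) = pd1_fun t.
Proof.
rewrite /swap_elt tens_pureB (linearB ev0).
have p1 : perm_eq [:: a_ 0; a_ 1; a_ 2] (enum 'I_3) by apply: perm_enum_ord.
have p2 : perm_eq [:: a_ 2; a_ 1; a_ 0] (enum 'I_3) by apply: perm_enum_ord.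
apply: etrans (eqB (ev0_word t p1) (ev0_word t p2)) _.
rewrite /pd1_fun !big_cons !big_nil !mulr1 !(tnth_nth 0) /=.
by rewrite !mulrA.
Qed.

Lemma tens_d0_in1 (x : N 2%N) :
  tens_map (K_d0 k) N (in1 x) = tens_pure (swap_elt k tt) x.
Proof. exact: tens_yoneda_coev. Qed.

Lemma ev0_d0_in1 x : ev0 (tens_map (K_d0 k) N (in1 x)) = pd1 A x.
Proof.
pose F := ev0 \o (tens_map (K_d0 k) N \o in1) : {linear tpow A 3 -> A}.
suff E : F =1 pd1 A by exact: E.
by apply: tpow_ext => t; rewrite pd1_tpure -ev0_swap -tens_d0_in1.
Qed.

Lemma ev0_d0 x : ev0 (tens_map (K_d0 k) N x) = pd1 A (ev1 x).
Proof. by rewrite -ev0_d0_in1 ev1K. Qed.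

Lemma pd2_inl_tpure (t : 4.-tuple A) : pd2 A (inl_lin (tpure t)) = pd2_fun t.
Proof.
rewrite -[LHS]/(pd2_fun_pair (tpure t, 0)) /pd2_fun_pair [X in X + _]tpow_liftE.
have := tpure3_linear2 1 1 (-1) (0 : A) 0.
by rewrite scaler0 addr0 scaleN1r addNr => ->; rewrite addr0.
Qed.

Lemma pd2_inr_tpure (t : 1.-tuple A) :
  pd2 A (inr_lin (tpure t)) = tpure [tuple 1; tnth t ord0; 1].
Proof.
rewrite -[LHS]/(pd2_fun_pair (0, tpow1_val (tpure t))) /pd2_fun_pair.
rewrite [X in X + _]linear0 add0r.
by rewrite -[(_, _).2]/(tpow1_val (tpure t)) tpow1_valE.
Qed.

Lemma ev1_quad (t : 4.-tuple A) :
  ev1 (tens_pure (quad_elt k) (tpure t : N 3%N)) = pd2_fun t.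
Proof.
rewrite /quad_elt !tens_pureD !(linearD ev1).
have p1 : perm_eq ([:: b_ 0; b_ 1] ++ [:: b_ 2] ++ [:: b_ 3]) (enum 'I_4).
  exact: perm_enum_ord.
have p2 : perm_eq ([:: b_ 3] ++ [:: b_ 2; b_ 0] ++ [:: b_ 1]) (enum 'I_4).
  exact: perm_enum_ord.
have p3 : perm_eq ([:: b_ 1; b_ 2; b_ 0] ++ [::] ++ [:: b_ 3]) (enum 'I_4).
  exact: perm_enum_ord.
have p4 : perm_eq ([:: b_ 3] ++ [:: b_ 1; b_ 2] ++ [:: b_ 0]) (enum 'I_4).
  exact: perm_enum_ord.
apply: etrans (eqD (eqD (eqD (ev1_triple t p1) (ev1_triple t p2))
  (ev1_triple t p3)) (ev1_triple t p4)) _.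
by rewrite !big_cons !big_nil !mulr1 !(tnth_nth 0) /= !mulrA.
Qed.

Lemma ev1_single (t : 1.-tuple A) :
  ev1 (tens_pure (single_elt k) (tpure t : N 0%N))
  = tpure [tuple 1; tnth t ord0; 1].
Proof.
have p : perm_eq ([::] ++ [:: ord0] ++ [::]) (enum 'I_1) by apply: perm_enum_ord.
apply: etrans (ev1_triple t p) _.
by rewrite !big_cons !big_nil !mulr1.
Qed.

Definition in2l : {linear N 3%N -> tensDS (K2 k) N} :=
  (@coev k bool K2_arity N true :
     {linear N (K2_arity true) -> tensDS (rep k K2_arity) N}).
Definition in2r : {linear N 0%N -> tensDS (K2 k) N} :=
  (@coev k bool K2_arity N false :
     {linear N (K2_arity false) -> tensDS (rep k K2_arity) N}).

Lemma tens_d1_in2l (x : N 3%N) :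
  tens_map (K_d1 k) N (in2l x) = tens_pure (quad_elt k) x.
Proof. exact: (tens_yoneda_coev (K2_elt k) (i := true)). Qed.

Lemma tens_d1_in2r (x : N 0%N) :
  tens_map (K_d1 k) N (in2r x) = tens_pure (single_elt k) x.
Proof. exact: (tens_yoneda_coev (K2_elt k) (i := false)). Qed.

Lemma ev2_in2l (x : N 3%N) : ev2 (in2l x) = inl_lin x.
Proof. exact: (rep_evE phi2 (i := true)). Qed.

Lemma ev2_in2r (x : N 0%N) : ev2 (in2r x) = inr_lin x.
Proof. exact: (rep_evE phi2 (i := false)). Qed.

Lemma ev1_d1_in2l x : ev1 (tens_map (K_d1 k) N (in2l x)) = pd2 A (inl_lin x).
Proof.
pose F := ev1 \o (tens_map (K_d1 k) N \o in2l) : {linear tpow A 4 -> tpow A 3}.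
pose G := pd2 A \o inl_lin : {linear tpow A 4 -> tpow A 3}.
suff E : F =1 G by exact: E.
apply: tpow_ext => t.
rewrite -[G _]/(pd2 A (inl_lin (tpure t))) pd2_inl_tpure.
by rewrite -ev1_quad -tens_d1_in2l.
Qed.

Lemma ev1_d1_in2r x : ev1 (tens_map (K_d1 k) N (in2r x)) = pd2 A (inr_lin x).
Proof.
pose F := ev1 \o (tens_map (K_d1 k) N \o in2r) : {linear tpow A 1 -> tpow A 3}.
pose G := pd2 A \o inr_lin : {linear tpow A 1 -> tpow A 3}.
suff E : F =1 G by exact: E.
apply: tpow_ext => t.
rewrite -[G _]/(pd2 A (inr_lin (tpure t))) pd2_inr_tpure.
by rewrite -ev1_single -tens_d1_in2r.
Qed.

Lemma ev1_d1 x : ev1 (tens_map (K_d1 k) N x) = pd2 A (ev2 x).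
Proof.
pose F := ev1 \o tens_map (K_d1 k) N : {linear tensDS (K2 k) N -> tpow A 3}.
pose G := pd2 A \o ev2 : {linear tensDS (K2 k) N -> tpow A 3}.
suff E : F =1 G by exact: E.
apply: tens_rep_ext => -[] y.
  change (ev1 (tens_map (K_d1 k) N (in2l y)) = pd2 A (ev2 (in2l y))).
  by rewrite ev1_d1_in2l -ev2_in2l.
change (ev1 (tens_map (K_d1 k) N (in2r y)) = pd2 A (ev2 (in2r y))).
by rewrite ev1_d1_in2r -ev2_in2r.
Qed.

Lemma ev2_onto u : exists x, ev2 x = u.
Proof.
case: u => u v; exists (in2l u + in2r (tpow1_in v)).
apply: etrans (linearD ev2 _ _) _.
apply: etrans (eqD (ev2_in2l u) (ev2_in2r (tpow1_in v))) _.
rewrite /inr_lin tpow1_inK.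
by congr (_, _); [apply: addr0 | apply: add0r].
Qed.

Lemma tens_d0_d1 x : tens_map (K_d0 k) N (tens_map (K_d1 k) N x) = 0.
Proof.
pose F := tens_map (K_d0 k) N \o tens_map (K_d1 k) N :
  {linear tensDS (K2 k) N -> tensDS (K0 k) N}.
suff E : F =1 \0 by exact: E.
apply: tens_ext => n y z.
change (tens_map (K_d0 k) N (tens_map (K_d1 k) N (tens_pure y z)) = 0).
rewrite !tens_mapE K_d0_d1 -[RHS](subrr (tens_pure (0 : K0 k n) z)).
by rewrite -tens_pureB subrr.
Qed.

Lemma pd1_pd2 u : pd1 A (pd2 A u) = 0.
Proof.
by have [x <-] := ev2_onto u; rewrite -ev1_d1 -ev0_d0 tens_d0_d1 raddf0.
Qed.

Lemma small_homology0 :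
  lmod_iso (pr_homology0 N (small_resolution k))
           (homology (\0 : {linear A -> zeromod k}) (pd1 A)).
Proof.
apply: (homology_iso (f := ev0) (g := in0)) => //.
- by move=> y; exists (ev1 y); apply: ev0_d0.
- by move=> y; exists (in1 y); rewrite -[y in LHS]in1K -ev0_d0; apply: ev0K.
- by move=> x _; exists 0; rewrite [X in X - x]ev0K subrr raddf0.
- by move=> x _; exists 0; rewrite [X in X - x]in0K subrr raddf0.
Qed.

Lemma small_homology1 :
  lmod_iso (pr_homology1 N (small_resolution k)) (homology (pd1 A) (pd2 A)).
Proof.
apply: (homology_iso (f := ev1) (g := in1)).
- by move=> x x0; rewrite -ev0_d0 x0 raddf0.
- by move=> y; exists (ev2 y); apply: ev1_d1.
- move=> x x0; apply: (can_inj ev0K); rewrite ev0_d0 in1K x0; exact/esym/raddf0.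
- move=> y; have [z <-] := ev2_onto y; exists z; by rewrite -ev1_d1 ev1K.
- by move=> x _; exists 0; rewrite ev1K subrr raddf0.
- by move=> x _; exists 0; rewrite in1K subrr raddf0.
Qed.

End Identification.

Theorem theorem128 (k : comPzRingType) (A : unital_algebra k) :
  [/\ forall u : (tpow A 4 * A)%type, pd1 A (pd2 A u) = 0,
      lmod_iso (HS A 0) (homology (\0 : {linear A -> zeromod k}) (pd1 A)) &
      lmod_iso (HS A 1) (homology (pd1 A) (pd2 A))].
Proof.
have [iso0 iso1] := pr_homology_iso (bsym A)
  (truncation (free_resolution (const_functor k))) (small_resolution k).
split; first exact: pd1_pd2.
- exact: lmod_iso_trans iso0 (small_homology0 A).
- exact: lmod_iso_trans iso1 (small_homology1 A).
Qed.
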